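(* Let $(\mathfrak{g},[\;,\;],\langle\;,\;\rangle)$ be a Lorentzian $2$-step nilpotent Lie algebra such that $\mathrm{Z}(\mathfrak{g})=[\mathfrak{g},\mathfrak{g}]$ is non-degenerate Lorentzian, and let $\omega\in\mathrm{Z}^2(\mathfrak{g},\mathbb{R})$. Then $\mathfrak{g}$ is $\omega$-quasi Einstein of type $1$ with nonnegative Einstein constant $\lambda$ if and only if $\lambda=0$ and one of the following holds: 1. $\dim\mathfrak{g}=5$ and there exist an orthonormal basis $\{e_1,e_2,u_1,u_2,u_3\}$ of $\mathfrak{g}$ with $\langle e_1,e_1\rangle=-1$, a real $\alpha\neq0$ and $\epsilon,\eta\in\{1,-1\}$ such that the only non-vanishing Lie brackets and values of $\omega$ on pairs of basis vectors (up to antisymmetry) are $[u_1,u_2]=\alpha e_2,\ [u_2,u_3]=\eta\alpha e_1,\ \omega(e_2,u_3)=\epsilon\alpha,\ \omega(e_1,u_1)=-\eta\epsilon\alpha;$ 2. $\dim\mathfrak{g}=6$ and there exist an orthonormal basis $\{e_1,e_2,e_3,u_1,u_2,u_3\}$ of $\mathfrak{g}$ with $\langle e_1,e_1\rangle=-1$, reals $\alpha_2,\alpha_3\neq0$, $\alpha=\sqrt{\alpha_2^2+\alpha_3^2}$, and $\epsilon,\eta\in\{1,-1\}$ such that the only non-vanishing Lie brackets and values of $\omega$ on pairs of basis vectors (up to antisymmetry) are $[u_1,u_2]=\alpha_2e_2,\ [u_1,u_3]=\alpha_3e_3,\ [u_2,u_3]=\epsilon\alpha e_1,\ \omega(e_2,u_3)=-\eta\epsilon\alpha_2,\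 \omega(e_3,u_2)=\eta\epsilon\alpha_3,\ \omega(e_1,u_1)=\eta\alpha.$
   Context: Lorentzian means a nondegenerate symmetric bilinear form of signature $(1,n-1)$. $\mathrm{Z}^2(\mathfrak{g},\mathbb{R})$ is the space of skew-symmetric bilinear forms $\omega$ on $\mathfrak{g}$ with $\omega([u,v],w)+\omega([v,w],u)+\omega([w,u],v)=0$. The Ricci operator $\mathrm{Ric}_{\mathfrak{g}}$ is defined via the Levi-Civita product $2\langle \mathrm{L}_uv,w\rangle=\langle[u,v],w\rangle+\langle[w,u],v\rangle+\langle[w,v],u\rangle$, $K(u,v)=\mathrm{L}_{[u,v]}-[\mathrm{L}_u,\mathrm{L}_v]$, $\langle\mathrm{Ric}_{\mathfrak{g}}u,v\rangle=\mathrm{tr}(w\mapsto K(u,w)v)$. Definition ($\omega$-quasi Einstein of type 1, for a 2-cocycle $\omega$ with values in $\mathbb{R}$ with its standard Euclidean product): let $S:\mathfrak{g}\to\mathfrak{g}$ be the skew-symmetric endomorphism with $\omega(u,v)=\langle Su,v\rangle$, and let $D:\mathfrak{g}\to\mathfrak{g}$ be defined by $\langle Du,v\rangle=\mathrm{tr}(\omega_u^*\circ\omega_v)$, where $\omega_u:\mathfrak{g}\to\mathbb{R}$, $v\mapsto\omega(u,v)$ and $\omega_u^*$ is its transpose (so $D=-S^2$). Then $\mathfrak{g}$ is $\omega$-quasi Einstein of type $1$ with Einstein constant $\lambda\in\mathbb{R}$ if $\{u\in\mathrm{Z}(\mathfrak{g}):\omega(u,\cdot)=0\}=\{0\}$,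 $\mathrm{Ric}_{\mathfrak{g}}=\lambda\,\mathrm{Id}_{\mathfrak{g}}+\tfrac12D$, and $\mathrm{tr}(S^2)=-4\lambda$. *)

(* Defs.v *)
From HB Require Import structures.
From mathcomp Require Import all_boot all_order all_algebra.
From mathcomp Require Import reals.
Set Implicit Arguments. Unset Strict Implicit. Unset Printing Implicit Defensive.
Import Order.TTheory GRing.Theory Num.Theory.
Local Open Scope ring_scope.

(* A Lie algebra g of dimension n is modelled on row vectors 'rV[R]_n.
   The bracket is given by the brackets c i j = [e_i, e_j] of the
   standard basis vectors and extended bilinearly. *)
Section LieDefs.
Variables (R : realType) (n : nat).
Local Notation vec := 'rV[R]_n.

Definition bvec (i : 'I_n) : vec := delta_mx 0 i.

Definition lbr (c : 'I_n -> 'I_n -> vec) (u v : vec) : vec :=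
  \sum_i \sum_j (u 0 i * v 0 j) *: c i j.

Definition ip (G : 'M[R]_n) (u v : vec) : R := (u *m G *m v^T) 0 0.

Definition om (Om : 'M[R]_n) (u v : vec) : R := (u *m Om *m v^T) 0 0.

Definition is_lie (c : 'I_n -> 'I_n -> vec) : Prop :=
  (forall i j, c i j = - c j i) /\
  (forall u v w, lbr c (lbr c u v) w + lbr c (lbr c v w) u
                 + lbr c (lbr c w u) v = 0).

Definition two_step_nilpotent (c : 'I_n -> 'I_n -> vec) : Prop :=
  (forall u v w, lbr c (lbr c u v) w = 0) /\ (exists u v, lbr c u v != 0).

Definition center (c : 'I_n -> 'I_n -> vec) (u : vec) : Prop :=
  forall v, lbr c u v = 0.

Definition derived (c : 'I_n -> 'I_n -> vec) (u : vec) : Prop :=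
  exists a : 'I_n -> 'I_n -> R,
    u = \sum_i \sum_j a i j *: lbr c (bvec i) (bvec j).

(* The subspace W is (nondegenerate) Lorentzian for the form G: it has a basis
   f_0,...,f_k which is orthonormal with <f_0,f_0> = -1, <f_i,f_i> = 1 (i>0),
   i.e. the restriction of G to W is nondegenerate of signature (1, dim W - 1). *)
Definition lorentzian_on (G : 'M[R]_n) (W : vec -> Prop) : Prop :=
  exists (k : nat) (f : 'I_k.+1 -> vec),
    (forall i, W (f i)) /\
    (forall a : 'I_k.+1 -> R, \sum_i a i *: f i = 0 -> forall i, a i = 0) /\
    (forall u, W u -> exists a : 'I_k.+1 -> R, u = \sum_i a i *: f i) /\
    (forall i j, ip G (f i) (f j) =
                 if i == j then (if i == ord0 then -1 else 1) else 0).

Definition lorentzian_metric (G : 'M[R]_n) : Prop :=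
  G^T = G /\ lorentzian_on G (fun _ => True).

Definition is_cocycle (c : 'I_n -> 'I_n -> vec) (Om : 'M[R]_n) : Prop :=
  Om^T = - Om /\
  (forall u v w, om Om (lbr c u v) w + om Om (lbr c v w) u
                 + om Om (lbr c w u) v = 0).

(* S with <S u, v> = om(u,v); endomorphisms act on the right: S u = u *m Smat *)
Definition Smat (G Om : 'M[R]_n) : 'M[R]_n := Om *m invmx G.
Definition Dmat (G Om : 'M[R]_n) : 'M[R]_n := - (Smat G Om *m Smat G Om).

(* Levi-Civita product: 2 <L_u v, w> = <[u,v],w> + <[w,u],v> + <[w,v],u> *)
Definition LC (c : 'I_n -> 'I_n -> vec) (G : 'M[R]_n) (u v : vec) : vec :=
  2^-1 *: ((\row_k (ip G (lbr c u v) (bvec k) + ip G (lbr c (bvec k) u) v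
                    + ip G (lbr c (bvec k) v) u)) *m invmx G).

Definition Kop (c : 'I_n -> 'I_n -> vec) (G : 'M[R]_n) (u v w : vec) : vec :=
  LC c G (lbr c u v) w - (LC c G u (LC c G v w) - LC c G v (LC c G u w)).

(* <Ric u, v> = tr (w |-> K(u,w) v) *)
Definition ric_form (c : 'I_n -> 'I_n -> vec) (G : 'M[R]_n) (u v : vec) : R :=
  \sum_k (Kop c G u (bvec k) v) 0 k.

Definition Ric (c : 'I_n -> 'I_n -> vec) (G : 'M[R]_n) (u : vec) : vec :=
  (\row_j ric_form c G u (bvec j)) *m invmx G.

Definition quasi_einstein1 (c : 'I_n -> 'I_n -> vec) (G Om : 'M[R]_n)
    (lam : R) : Prop :=
  (forall u, center c u -> (forall v, om Om u v = 0) -> u = 0) /\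
  (forall u, Ric c G u = lam *: u + 2^-1 *: (u *m Dmat G Om)) /\
  \tr (Smat G Om *m Smat G Om) = - 4%:R * lam.

Definition orthonormal (G : 'M[R]_n) (b : 'I_n -> vec) : Prop :=
  forall i j, ip G (b i) (b j) =
              if i == j then (if val i == 0%N then -1 else 1) else 0.

End LieDefs.

(* Case 1: basis (e1,e2,u1,u2,u3) = indices (0,1,2,3,4).
   Structure constants [b_i,b_j] = sum_k T1 i j k b_k and omega(b_i,b_j) = W1 i j. *)
Definition T1 {R : realType} (a eta : R) (i j k : nat) : R :=
  match i, j, k with
  | 2, 3, 1 => a | 3, 2, 1 => - a
  | 3, 4, 0 => eta * a | 4, 3, 0 => - (eta * a)
  | _, _, _ => 0 end.

Definition W1 {R : realType} (a eps eta : R) (i j : nat) : R :=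
  match i, j with
  | 1, 4 => eps * a | 4, 1 => - (eps * a)
  | 0, 2 => - (eta * eps * a) | 2, 0 => eta * eps * a
  | _, _ => 0 end.

(* Case 2: basis (e1,e2,e3,u1,u2,u3) = indices (0,1,2,3,4,5). *)
Definition T2 {R : realType} (a2 a3 a eps : R) (i j k : nat) : R :=
  match i, j, k with
  | 3, 4, 1 => a2 | 4, 3, 1 => - a2
  | 3, 5, 2 => a3 | 5, 3, 2 => - a3
  | 4, 5, 0 => eps * a | 5, 4, 0 => - (eps * a)
  | _, _, _ => 0 end.

Definition W2 {R : realType} (a2 a3 a eps eta : R) (i j : nat) : R :=
  match i, j with
  | 1, 5 => - (eta * eps * a2) | 5, 1 => eta * eps * a2
  | 2, 4 => eta * eps * a3 | 4, 2 => - (eta * eps * a3)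
  | 0, 3 => eta * a | 3, 0 => - (eta * a)
  | _, _ => 0 end.

Definition case1 {R : realType} {n : nat} (c : 'I_n -> 'I_n -> 'rV[R]_n)
    (G Om : 'M[R]_n) : Prop :=
  n = 5%N /\
  exists (b : 'I_n -> 'rV[R]_n) (a eps eta : R),
    a != 0 /\ (eps = 1 \/ eps = -1) /\ (eta = 1 \/ eta = -1) /\
    orthonormal G b /\
    (forall i j, lbr c (b i) (b j) = \sum_(k < n) T1 a eta i j k *: b k) /\
    (forall i j, om Om (b i) (b j) = W1 a eps eta i j).

Definition case2 {R : realType} {n : nat} (c : 'I_n -> 'I_n -> 'rV[R]_n)
    (G Om : 'M[R]_n) : Prop :=
  n = 6%N /\
  exists (b : 'I_n -> 'rV[R]_n) (a2 a3 eps eta : R),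
    let a := Num.sqrt (a2 ^+ 2 + a3 ^+ 2) in
    a2 != 0 /\ a3 != 0 /\ (eps = 1 \/ eps = -1) /\ (eta = 1 \/ eta = -1) /\
    orthonormal G b /\
    (forall i j, lbr c (b i) (b j) = \sum_(k < n) T2 a2 a3 a eps i j k *: b k) /\
    (forall i j, om Om (b i) (b j) = W2 a2 a3 a eps eta i j).

(* Main.v *)
(* Write z for the center, which is Lorentzian, and V for its Euclidean
   orthogonal.  The cocycle vanishes on z x z, so it gives an injection
   A : z -> V, and V has an orthonormal basis y_u diagonalising A A^*, with
   eigenvalues h_u of which exactly one, h_o, is negative.  The vectors
   w_u = A^* y_u are orthogonal of square norm h_u and span z.  Put
   b_uvk = omega([y_u, y_v], y_k).  This array is antisymmetric in u, v, has zero
   cyclic sums, and the Einstein equations become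
     sum_uv b_uvk^2 = 4 lambda h_k + 2 h_k^2,
     sum_vk b_uvk^2 / h_k + 2 lambda + h_u + |B y_u|^2 = 0,
   where B is the V-part of omega.  Their traces give
   sum_u h_u = - C lambda <= 0, hence h_j + h_k <= - h_o for spacelike j <> k.
   Adding these equations with weight 1 at the positive eigenvalues, -3/4 at o and
   0 at the null ones, and symmetrising over cyclic permutations, one gets a
   vanishing sum over triples of which every term is nonnegative.  Hence all terms
   vanish, which leaves only b_ojk with h_j + h_k = - h_o; then lambda = 0, B = 0
   and V = <y_o, y_j, y_k>.  The case h_j = 0 is the five-dimensional algebra and
   h_j > 0 the six-dimensional one. *)
Require Import Defs.
From HB Require Import structures.
From mathcomp Require Import all_boot all_order all_algebra.
From mathcomp Require Import reals.
From mathcomp Require Import ring lra.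
From mathcomp Require spectral complex.
Import Order.TTheory GRing.Theory Num.Theory.
Local Open Scope ring_scope.

Set Implicit Arguments.
Unset Strict Implicit.
Unset Printing Implicit Defensive.

(** * Simultaneous diagonalisation *)

Definition posdef {R : realType} {n : nat} (M : 'M[R]_n) : Prop :=
  forall x : 'rV[R]_n, x != 0 -> 0 < (x *m M *m x^T) 0 0.

Lemma form_sym {R : realType} {n : nat} (M : 'M[R]_n) (u v : 'rV[R]_n) :
  M^T = M -> (u *m M *m v^T) 0 0 = (v *m M *m u^T) 0 0.
Proof.
move=> sM; transitivity ((u *m M *m v^T)^T 0 0); first by rewrite [RHS]mxE.
by rewrite !trmx_mul trmxK sM mulmxA.
Qed.

Lemma posdef_unit {R : realType} {n : nat} (M : 'M[R]_n) : posdef M -> M \in unitmx.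
Proof.
move=> pM; rewrite -row_free_unit; apply/inj_row_free => v vM.
by apply/eqP/contraT => /pM; rewrite vM mul0mx mxE ltxx.
Qed.

Section Complexification.
Import complex.
Local Notation C R := (complex.complex R).

(** An eigenvector [u + iv] of [A] for an eigenvalue [a + ib] exists over the algebraically closed
    field of complex numbers; the two equations are the real and imaginary parts of the eigenvalue
    equation. *)
Lemma complex_eigenvector {R : realType} {n : nat} (A : 'M[R]_n) : (0 < n)%N ->
  exists a b (u v : 'rV[R]_n), [/\ (u != 0) || (v != 0),
    u *m A = a *: u - b *: v & v *m A = b *: u + a *: v].
Proof.
move=> n_gt0.
pose f : {rmorphism R -> C R} := complex.real_complex R.
have [z /eigenvalueP[x xA xn0]] := @spectral.eigenvalue_closed (C R) n (map_mx f A) n_gt0.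
pose u : 'rV[R]_n := \row_i complex.Re (x 0 i).
pose v : 'rV[R]_n := \row_i complex.Im (x 0 i).
have xE i : x 0 i = complex.Complex (u 0 i) (v 0 i).
  by rewrite !mxE; case: (x 0 i).
have key j : x 0 j * z = complex.Complex (\sum_i u 0 i * A i j) (\sum_i v 0 i * A i j).
  move/rowP: xA => /(_ j); rewrite !mxE mulrC => <-.
  under eq_bigr do rewrite !mxE xE.
  elim/big_ind3 : _ => //= [a b c d e g -> ->|i _]; first by [].
  by rewrite /GRing.mul/= !mulr0 subr0 add0r.
exists (complex.Re z), (complex.Im z), u, v; split.
- apply: contra_neqT xn0; rewrite negb_or !negbK => /andP[/eqP u0 /eqP v0].
  by apply/rowP => i; rewrite xE u0 v0 !mxE.
- apply/rowP => j; have := key j; rewrite xE; case: (z) => a b /=.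
  by rewrite /GRing.mul/= => -[] + _; rewrite !mxE => <-; ring.
apply/rowP => j; have := key j; rewrite xE; case: (z) => a b /=.
by rewrite /GRing.mul/= => -[] _; rewrite !mxE => <-; ring.
Qed.
End Complexification.

(* An eigenvector of the pencil (H, M): the eigenvalues of H M^-1 are real
   because M is definite. *)
Lemma pencil_eigenvector {R : realType} {n : nat} (M H : 'M[R]_n) : (0 < n)%N ->
  M^T = M -> H^T = H -> posdef M ->
  exists a (x : 'rV[R]_n), x != 0 /\ x *m H = a *: (x *m M).
Proof.
move=> n_gt0 sM sH pM.
have [a [b [u [v [nz uA vA]]]]] := complex_eigenvector (H *m invmx M) n_gt0.
have Mu := posdef_unit pM.
have uH : u *m H = a *: (u *m M) - b *: (v *m M).
  by rewrite -[LHS](mulmxKV Mu) -(mulmxA u) uA mulmxBl -!scalemxAl.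
have vH : v *m H = b *: (u *m M) + a *: (v *m M).
  by rewrite -[LHS](mulmxKV Mu) -(mulmxA v) vA mulmxDl -!scalemxAl.
have nn (w : 'rV[R]_n) : 0 <= (w *m M *m w^T) 0 0.
  have [->|w0] := eqVneq w 0; last exact: ltW (pM _ w0).
  by rewrite mul0mx mul0mx mxE.
(* Evaluating [u H v^T] as [v H u^T] as well, by symmetry of [H] and [M], leaves [b] times the sum
   of the two [M]-norms, which is positive. *)
have b0 : b = 0.
  have e : a * (u *m M *m v^T) 0 0 - b * (v *m M *m v^T) 0 0 =
           b * (u *m M *m u^T) 0 0 + a * (u *m M *m v^T) 0 0.
    transitivity ((u *m H *m v^T) 0 0).
      rewrite uH mulmxBl -!scalemxAl.
      by move: (u *m M *m v^T) (v *m M *m v^T) => X Y; rewrite !mxE.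
    rewrite (form_sym u v sH) vH mulmxDl -!scalemxAl (form_sym u v sM).
    by move: (u *m M *m u^T) (v *m M *m u^T) => X Y; rewrite !mxE.
  have {}e : b * ((u *m M *m u^T) 0 0 + (v *m M *m v^T) 0 0) = 0 by lra.
  move/eqP: e; rewrite mulf_eq0 => /orP[/eqP//|/eqP s0].
  have hu := nn u; have hv := nn v.
  have /orP[/pM|/pM] := nz; lra.
rewrite b0 !scale0r ?subr0 ?add0r in uH vH.
by have /orP[w0|w0] := nz; [exists a, u|exists a, v].
Qed.

(** Induction on the dimension. For a pencil eigenvector [x] the form [x H] is a multiple of [x M],
    so the [M]-orthogonal of [x] is also [H]-orthogonal to it. Both forms are restricted there, and
    the normalised [x] is adjoined to the basis found. *)
Lemma simultaneous_diagonalization {R : realType} {n : nat} (M H : 'M[R]_n) :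
  M^T = M -> H^T = H -> posdef M ->
  exists (T : 'M[R]_n) (d : 'rV[R]_n),
    T *m M *m T^T = 1%:M /\ T *m H *m T^T = diag_mx d.
Proof.
elim: n => [|n IHn] in M H *; first by exists 0, 0; split; apply/matrixP => -[].
move=> sM sH pM.
have [a [x [xn0 xH]]] := pencil_eigenvector (ltn0Sn n) sM sH pM.
pose N := M *m x^T.
have rN : \rank N = 1%N.
  apply/eqP; rewrite eqn_leq rank_leq_col lt0n mxrank_eq0.
  apply: contraTneq (pM _ xn0) => N0; by rewrite -mulmxA -/N N0 mulmx0 mxE ltxx.
(* The rows of [K] form a basis of the [M]-orthogonal of [x]; there are [n] of them because [N] has
   rank 1. *)
have [K [Kf KN]] : exists K : 'M[R]_(n, n.+1), row_free K /\ K *m N = 0.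
  have rK : \rank (kermx N) = n by rewrite mxrank_ker rN subn1.
  have := row_base_free (kermx N); have := eq_row_base (kermx N).
  move: (row_base _); rewrite rK => K eK fK; exists K; split => //.
  by apply/sub_kermxP; rewrite eK.
have pM' : posdef (K *m M *m K^T).
  move=> y yn0; have := pM (y *m K); rewrite trmx_mul !mulmxA; apply.
  by apply: contra_neq yn0 => yK; apply/eqP; rewrite -(mulmx_free_eq0 _ Kf) yK.
have [||T [d [TM TH]]] := IHn (K *m M *m K^T) (K *m H *m K^T) _ _ pM'.
- by rewrite !trmx_mul trmxK sM mulmxA.
- by rewrite !trmx_mul trmxK sH mulmxA.
pose m := (x *m M *m x^T) 0 0.
have m0 : 0 < m := pM _ xn0.
pose s := Num.sqrt m.
have s0 : s != 0 by rewrite gt_eqF// sqrtr_gt0.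
have s2 : s * s = m by rewrite -expr2 sqr_sqrtr// ltW.
pose y := s^-1 *: x.
have yH : y *m H = a *: (y *m M) by rewrite -!scalemxAl xH scalerA mulrC -scalerA.
have KMy : K *m M *m y^T = 0.
  by rewrite linearZ/= -scalemxAr -mulmxA KN scaler0.
have yMK : y *m M *m K^T = 0.
  by apply: trmx_inj; rewrite !trmx_mul trmxK sM trmx0 mulmxA KMy.
have yMy : y *m M *m y^T = 1%:M.
  apply/matrixP => i j; rewrite !ord1 linearZ/= -scalemxAr -!scalemxAl scalerA mxE -/m.
  by rewrite mxE eqxx/= -s2 -invfM mulVf// mulf_neq0.
clearbody y.
pose T1 : 'M[R]_(1 + n) := col_mx y (T *m K).
have blk (N1 : 'M[R]_(1 + n)) : T1 *m N1 *m T1^T =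
    block_mx (y *m N1 *m y^T) (y *m N1 *m K^T *m T^T)
             (T *m (K *m N1 *m y^T)) (T *m (K *m N1 *m K^T) *m T^T).
  by rewrite /T1 tr_col_mx mul_col_mx mul_col_mx !mul_mx_row trmx_mul !mulmxA -block_mxEv.
exists T1, (row_mx (a%:M : 'rV_1) d : 'rV_(1 + n)); split.
  apply: (etrans (blk M)); rewrite yMy yMK KMy TM mul0mx mulmx0.
  by rewrite -scalar_mx_block.
have KHy : K *m H *m y^T = 0.
  by apply: trmx_inj; rewrite !trmx_mul sH trmxK trmx0 mulmxA yH -scalemxAl yMK scaler0.
apply: (etrans (blk H)).
rewrite KHy TH yH -!scalemxAl yMy yMK mul0mx scaler0 mulmx0.
apply: (etrans _ (esym (diag_mx_row _ _))); congr (block_mx _ _ _ _).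
by apply/matrixP => i j; rewrite !ord1 !mxE /= !mulr1n mulr1.
Qed.

(** * Frames and the Ricci form *)

Section BilinearForms.
Variables (R : realType) (n : nat) (c : 'I_n -> 'I_n -> 'rV[R]_n).
Implicit Types (M : 'M[R]_n) (u v w : 'rV[R]_n).

Lemma omE M : om M = ip M. Proof. by []. Qed.

Lemma ip_lin_l M a u u' v : ip M (a *: u + u') v = a * ip M u v + ip M u' v.
Proof.
by rewrite /ip mulmxDl mulmxDl -!scalemxAl; move: (_ *m _) (_ *m _) => X Y; rewrite !mxE.
Qed.

Lemma ip_lin_r M a u u' v : ip M v (a *: u + u') = a * ip M v u + ip M v u'.
Proof.
rewrite /ip linearP mulmxDr -scalemxAr; move: (_ *m _) (_ *m _) => X Y.
by rewrite !mxE.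
Qed.

Lemma ip0l M v : ip M 0 v = 0. Proof. by rewrite /ip !mul0mx mxE. Qed.
Lemma ip0r M v : ip M v 0 = 0. Proof. by rewrite /ip trmx0 mulmx0 mxE. Qed.

Lemma ipDl M u u' v : ip M (u + u') v = ip M u v + ip M u' v.
Proof. by rewrite -[u]scale1r ip_lin_l mul1r scale1r. Qed.
Lemma ipDr M u u' v : ip M v (u + u') = ip M v u + ip M v u'.
Proof. by rewrite -[u]scale1r ip_lin_r mul1r scale1r. Qed.
Lemma ipZl M a u v : ip M (a *: u) v = a * ip M u v.
Proof. by rewrite -[_ *: u]addr0 ip_lin_l ip0l addr0. Qed.
Lemma ipZr M a u v : ip M v (a *: u) = a * ip M v u.
Proof. by rewrite -[_ *: u]addr0 ip_lin_r ip0r addr0. Qed.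
Lemma ipNl M u v : ip M (- u) v = - ip M u v.
Proof. by rewrite -scaleN1r ipZl mulN1r. Qed.
Lemma ipBl M u u' v : ip M (u - u') v = ip M u v - ip M u' v.
Proof. by rewrite ipDl ipNl. Qed.
Lemma ip_suml M (I : finType) (F : I -> 'rV[R]_n) v :
  ip M (\sum_i F i) v = \sum_i ip M (F i) v.
Proof. by rewrite (big_morph (ip M ^~ v) (fun u u' => ipDl M u u' v) (ip0l M v)). Qed.
Lemma ip_sumr M (I : finType) (F : I -> 'rV[R]_n) v :
  ip M v (\sum_i F i) = \sum_i ip M v (F i).
Proof. by rewrite (big_morph (ip M v) (fun u u' => ipDr M u u' v) (ip0r M v)). Qed.

Lemma ip_sym M u v : M^T = M -> ip M u v = ip M v u.
Proof. exact: form_sym. Qed.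

Lemma ip_skew M u v : M^T = - M -> ip M u v = - ip M v u.
Proof.
move=> sM; rewrite /ip; transitivity ((u *m M *m v^T)^T 0 0).
  by rewrite [RHS]mxE.
rewrite !trmx_mul trmxK sM mulmxA mulmxN mulNmx.
by move: (_ *m _) => X; rewrite mxE.
Qed.

Lemma lbr_lin_l a u u' v : lbr c (a *: u + u') v = a *: lbr c u v + lbr c u' v.
Proof.
rewrite /lbr scaler_sumr -big_split; apply: eq_bigr => i _.
rewrite scaler_sumr -big_split; apply: eq_bigr => j _ /=.
by rewrite scalerA -scalerDl !mxE mulrDl mulrA.
Qed.

Lemma lbr_lin_r a u u' v : lbr c v (a *: u + u') = a *: lbr c v u + lbr c v u'.
Proof.
rewrite /lbr scaler_sumr -big_split; apply: eq_bigr => i _.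
rewrite scaler_sumr -big_split; apply: eq_bigr => j _ /=.
by rewrite scalerA -scalerDl !mxE; congr (_ *: _); ring.
Qed.

Lemma lbr0l v : lbr c 0 v = 0.
Proof. by have := lbr_lin_l (-1) 0 0 v; rewrite scaler0 addr0 scaleN1r addNr. Qed.
Lemma lbr0r v : lbr c v 0 = 0.
Proof. by have := lbr_lin_r (-1) 0 0 v; rewrite scaler0 addr0 scaleN1r addNr. Qed.
Lemma lbrDl u u' v : lbr c (u + u') v = lbr c u v + lbr c u' v.
Proof. by rewrite -[u]scale1r lbr_lin_l !scale1r. Qed.
Lemma lbrDr u u' v : lbr c v (u + u') = lbr c v u + lbr c v u'.
Proof. by rewrite -[u]scale1r lbr_lin_r !scale1r. Qed.
Lemma lbrZl a u v : lbr c (a *: u) v = a *: lbr c u v.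
Proof. by rewrite -[_ *: u]addr0 lbr_lin_l lbr0l addr0. Qed.
Lemma lbrZr a u v : lbr c v (a *: u) = a *: lbr c v u.
Proof. by rewrite -[_ *: u]addr0 lbr_lin_r lbr0r addr0. Qed.
Lemma lbr_suml (I : finType) (F : I -> 'rV[R]_n) v :
  lbr c (\sum_i F i) v = \sum_i lbr c (F i) v.
Proof. by rewrite (big_morph (lbr c ^~ v) (fun u u' => lbrDl u u' v) (lbr0l v)). Qed.
Lemma lbr_sumr (I : finType) (F : I -> 'rV[R]_n) v :
  lbr c v (\sum_i F i) = \sum_i lbr c v (F i).
Proof. by rewrite (big_morph (lbr c v) (fun u u' => lbrDr u u' v) (lbr0r v)). Qed.

Lemma lbr_skew : is_lie c -> forall u v, lbr c u v = - lbr c v u.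
Proof.
move=> [sc _] u v; rewrite /lbr -sumrN exchange_big; apply: eq_bigr => j _.
by rewrite -sumrN; apply: eq_bigr => i _; rewrite sc scalerN mulrC.
Qed.

Lemma lbr_alt : is_lie c -> forall u, lbr c u u = 0.
Proof.
move=> lc u; apply/rowP => k; have /rowP/(_ k) := lbr_skew lc u u.
by rewrite !mxE; lra.
Qed.

Lemma row_bvec v : v = \sum_k v 0 k *: bvec R k.
Proof. exact: row_sum_delta. Qed.

End BilinearForms.

Lemma sum_antisym {R : realType} {I : finType} (F : I -> I -> R) :
  (forall k l, F k l = - F l k) -> \sum_k \sum_l F k l = 0.
Proof.
move=> aF; suff e : \sum_k \sum_l F k l = - \sum_k \sum_l F k l by lra.
rewrite [LHS]exchange_big -sumrN; apply: eq_bigr => k _.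
by rewrite -sumrN; apply: eq_bigr => l _.
Qed.

(* Both an orthonormal basis with signs e and an orthogonal basis f with
   e i = 1 / <f i, f i> are frames; a frame may also contain zero vectors. *)
Definition frame {R : realType} {n : nat} (G : 'M[R]_n) {I : finType}
    (e : I -> R) (f : I -> 'rV[R]_n) : Prop :=
  forall v, v = \sum_i (e i * ip G v (f i)) *: f i.

(** * Levi-Civita product, traces and Ricci form in a frame *)

Section FrameTheory.
Variables (R : realType) (n : nat) (c : 'I_n -> 'I_n -> 'rV[R]_n) (G : 'M[R]_n).
Hypothesis symG : G^T = G.
Variables (I : finType) (e : I -> R) (f : I -> 'rV[R]_n).
Hypothesis frf : frame G e f.

(** The frame expansion of [v] depends on [v] only through [v G], so [v G = 0] forces [v = 0]. *)
Lemma frame_unit : G \in unitmx.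
Proof.
rewrite -row_free_unit; apply/inj_row_free => v vG; rewrite (frf v) big1// => i _.
by rewrite /ip vG mul0mx mxE mulr0 scale0r.
Qed.

Lemma frame_ip u v : ip G u v = \sum_i e i * ip G u (f i) * ip G v (f i).
Proof.
rewrite {1}(frf u) ip_suml; apply: eq_bigr => i _.
by rewrite ipZl (ip_sym _ v symG).
Qed.

Lemma ip_ext u v : (forall w, ip G u w = ip G v w) -> u = v.
Proof.
move=> uv; rewrite (frf u) (frf v); apply: eq_bigr => i _; by rewrite uv.
Qed.

Lemma frame_ext u v : (forall i, ip G u (f i) = ip G v (f i)) -> u = v.
Proof. by move=> uv; rewrite (frf u) (frf v); apply: eq_bigr => i _; rewrite uv. Qed.

Lemma ip_row_invmx (r w : 'rV[R]_n) : ip G (r *m invmx G) w = \sum_k r 0 k * w 0 k.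
Proof.
rewrite /ip mulmxKV ?frame_unit// mxE; apply: eq_bigr => k _.
by rewrite [w^T _ _]mxE.
Qed.

Lemma LC_ip u v w : ip G (LC c G u v) w =
  2^-1 * (ip G (lbr c u v) w + ip G (lbr c w u) v + ip G (lbr c w v) u).
Proof.
rewrite /LC ipZl ip_row_invmx; congr (_ * _).
rewrite {2 3 4}(row_bvec w) ip_sumr !lbr_suml !ip_suml -!big_split.
apply: eq_bigr => k _ /=; rewrite mxE ipZr !lbrZl !ipZl; ring.
Qed.

Lemma LC_lin_l a u u' v : LC c G (a *: u + u') v = a *: LC c G u v + LC c G u' v.
Proof.
apply: ip_ext => w; rewrite ip_lin_l !LC_ip lbr_lin_l lbr_lin_r !ip_lin_l ip_lin_r.
ring.
Qed.

Lemma LC_lin_r a u u' v : LC c G v (a *: u + u') = a *: LC c G v u + LC c G v u'.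
Proof.
apply: ip_ext => w; rewrite ip_lin_l !LC_ip !lbr_lin_r !ip_lin_l ip_lin_r.
ring.
Qed.

Lemma scaler_subB (a : R) (x x' y y' z z' : 'rV[R]_n) :
  (a *: x + x') - ((a *: y + y') - (a *: z + z')) =
  a *: (x - (y - z)) + (x' - (y' - z')).
Proof. by apply/rowP => k; rewrite !mxE; ring. Qed.

Lemma Kop_lin_r a u w v v' :
  Kop c G u w (a *: v + v') = a *: Kop c G u w v + Kop c G u w v'.
Proof.
rewrite /Kop (LC_lin_r a v v' (lbr c u w)) (LC_lin_r a v v' u) (LC_lin_r a v v' w).
rewrite (LC_lin_r _ _ _ u) (LC_lin_r _ _ _ w); exact: scaler_subB.
Qed.

Lemma Kop_lin_m a u v w w' :
  Kop c G u (a *: w + w') v = a *: Kop c G u w v + Kop c G u w' v.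
Proof.
rewrite /Kop lbr_lin_r (LC_lin_l _ (lbr c u w)) (LC_lin_l _ w w').
rewrite (LC_lin_r _ _ _ u) (LC_lin_l _ w w'); exact: scaler_subB.
Qed.

Lemma linear_sum (phi : 'rV[R]_n -> 'rV[R]_n) (J : finType) (a : J -> R) (x : J -> 'rV[R]_n) :
  (forall a x y, phi (a *: x + y) = a *: phi x + phi y) ->
  phi (\sum_j a j *: x j) = \sum_j a j *: phi (x j).
Proof.
move=> lphi; have phi0 : phi 0 = 0.
  by have := lphi (-1) 0 0; rewrite scaler0 addr0 scaleN1r addNr.
have phiD : {morph phi : x y / x + y}.
  by move=> y z; rewrite -[y]scale1r lphi !scale1r.
rewrite (big_morph phi phiD phi0); apply: eq_bigr => j _.
by rewrite -[_ *: x j]addr0 lphi phi0 addr0.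
Qed.

(** The identity is the sum of the rank one maps [v |-> e i <v, f i> f i], and [phi] composed with
    such a map has trace [e i <phi (f i), f i>]. Independence of the [f i] does not enter, so zero
    vectors are harmless. *)
Lemma frame_trace (phi : 'rV[R]_n -> 'rV[R]_n) :
  (forall a x y, phi (a *: x + y) = a *: phi x + phi y) ->
  \sum_k phi (bvec R k) 0 k = \sum_i e i * ip G (phi (f i)) (f i).
Proof.
move=> lphi; transitivity (\sum_k \sum_i (e i * ip G (bvec R k) (f i)) * phi (f i) 0 k).
  apply: eq_bigr => k _; rewrite {1}(frf (bvec R k)) linear_sum// summxE.
  by apply: eq_bigr => i _; rewrite mxE.
rewrite exchange_big; apply: eq_bigr => i _ /=.
rewrite [in RHS](row_bvec (phi (f i))) ip_suml mulr_sumr; apply: eq_bigr => k _.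
rewrite ipZl; ring.
Qed.

Lemma ric_form_lin a u v v' :
  ric_form c G u (a *: v + v') = a * ric_form c G u v + ric_form c G u v'.
Proof.
rewrite /ric_form mulr_sumr -big_split; apply: eq_bigr => k _ /=.
rewrite Kop_lin_r; move: (Kop c G u _ v) (Kop c G u _ v') => x y.
by rewrite !mxE.
Qed.

Lemma Ric_ip u v : ip G (Ric c G u) v = ric_form c G u v.
Proof.
rewrite ip_row_invmx.
have r0 : ric_form c G u 0 = 0.
  by have := ric_form_lin (-1) u 0 0; rewrite scaler0 addr0 mulN1r addNr.
have rD : {morph ric_form c G u : x y / x + y}.
  by move=> y z; rewrite -[y]scale1r ric_form_lin mul1r scale1r.
rewrite [in RHS](row_bvec v) (big_morph _ rD r0); apply: eq_bigr => k _.
by rewrite mxE -[v 0 k *: _]addr0 ric_form_lin r0 addr0 mulrC.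
Qed.

Hypothesis lc : is_lie c.
Hypothesis nil2 : forall u v w, lbr c (lbr c u v) w = 0.
Hypothesis adf : forall w i, ip G (lbr c w (f i)) (f i) = 0.

Lemma LC_skew u v w : ip G (LC c G u v) w = - ip G v (LC c G u w).
Proof.
rewrite (ip_sym v _ symG) !LC_ip (lbr_skew lc w v) (lbr_skew lc w u).
rewrite (lbr_skew lc v u) !ipNl; ring.
Qed.

(** The three terms of [K(u, f k) v] are paired with [f k]. Two-step nilpotency reduces the
    [L_[u, f k]] term to one product of brackets, skewness moves [L_u] onto [f k], and the term with
    [L_(f k)] outermost vanishes since [adf] makes [L_(f k) (f k)] orthogonal to everything. *)
Lemma Kop_trace_term u v k :
  ip G (Kop c G u (f k) v) (f k) =
  - 2^-1 * ip G (lbr c u (f k)) (lbr c v (f k)) + ip G (LC c G (f k) v) (LC c G u (f k)).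
Proof.
rewrite /Kop !ipBl; set x := LC c G u v; set y := LC c G (f k) v.
have -> : ip G (LC c G (f k) x) (f k) = 0.
  by rewrite LC_skew (ip_sym _ _ symG) LC_ip adf lbr_alt// ip0l !addr0 mulr0 oppr0.
rewrite [ip G (LC c G u y) _]LC_skew LC_ip nil2 ip0l.
rewrite (lbr_skew lc (f k) (lbr c _ _)) nil2 oppr0 ip0l.
rewrite (lbr_skew lc (f k) v) ipNl (ip_sym (lbr c v _) _ symG); ring.
Qed.

Lemma ric_form_frame u v : ric_form c G u v =
  - 2^-1 * (\sum_k e k * ip G (lbr c u (f k)) (lbr c v (f k))) +
  4^-1 * (\sum_k \sum_l e k * e l * (ip G (lbr c (f k) (f l)) u * ip G (lbr c (f k) (f l)) v)).
Proof.
rewrite /ric_form (frame_trace (phi := fun w => Kop c G u w v)); last first.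
  by move=> *; rewrite Kop_lin_m.
under eq_bigr do rewrite Kop_trace_term mulrDr mulrCA.
rewrite big_split /= -mulr_sumr; congr (_ + _).
pose X v k l := ip G (lbr c v (f k)) (f l).
pose P v k l := ip G (lbr c (f k) (f l)) v.
have PN w k l : P w k l = - P w l k by rewrite /P (lbr_skew lc) ipNl.
(* Summing over [l] rebuilds [<[f k, [u, f k]], v>], which is zero by nilpotency. *)
have PX : \sum_k \sum_l e k * e l * (P v k l * X u k l) = 0.
  apply: big1 => k _; transitivity (e k * ip G (lbr c (f k) (lbr c u (f k))) v).
    rewrite {1}(frf (lbr c u (f k))) lbr_sumr ip_suml mulr_sumr.
    by apply: eq_bigr => l _; rewrite lbrZr ipZl /P /X; ring.
  by rewrite (lbr_skew lc) nil2 oppr0 ip0l mulr0.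
(* The product of two Koszul formulas is regrouped: the wanted term, a factor symmetric in [k, l]
   times an antisymmetric one, and two sums that reduce to [PX]. *)
transitivity (\sum_k \sum_l (4^-1 * (e k * e l * (P u k l * P v k l))
   + 4^-1 * (e k * e l * ((X v k l + X v l k) * (X u l k - X u k l + P u k l)))
   - 4^-1 * (e k * e l * (P v k l * X u k l)) + 4^-1 * (e l * e k * (P v k l * X u l k)))).
  apply: eq_bigr => k _; rewrite frame_ip mulr_sumr; apply: eq_bigr => l _.
  rewrite !LC_ip (lbr_skew lc (f k) v) (lbr_skew lc (f l) v) (lbr_skew lc (f l) u).
  rewrite (lbr_skew lc (f l) (f k)) !ipNl.
  rewrite -/(P v k l) -/(P u k l) -/(X v k l) -/(X v l k) -/(X u k l) -/(X u l k).
  by field.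
have split4 (F1 F2 F3 F4 : I -> I -> R) (a : R) :
    \sum_k \sum_l (a * F1 k l + a * F2 k l - a * F3 k l + a * F4 k l) =
    a * (\sum_k \sum_l F1 k l) + a * (\sum_k \sum_l F2 k l)
    - a * (\sum_k \sum_l F3 k l) + a * (\sum_k \sum_l F4 k l).
  rewrite !mulr_sumr -sumrN -!big_split; apply: eq_bigr => k _ /=.
  by rewrite !mulr_sumr -sumrN -!big_split.
rewrite split4 PX.
rewrite (sum_antisym (F := fun k l => _ * ((X v k l + _) * _))); last first.
  by move=> k l; rewrite (PN u l k); ring.
rewrite [X in _ + _ * X = _]exchange_big /=.
under [X in _ + _ * X = _]eq_bigr do under eq_bigr do rewrite PN mulNr mulrN.
under [X in _ + _ * X = _]eq_bigr do rewrite sumrN.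
by rewrite sumrN PX oppr0 !mulr0 subr0 !addr0.
Qed.

Variable Om : 'M[R]_n.
Hypothesis skO : Om^T = - Om.

Lemma Smat_ip u v : ip G (u *m Smat G Om) v = om Om u v.
Proof. by rewrite /ip /Smat mulmxA mulmxKV ?frame_unit. Qed.

Lemma Dmat_ip u v : ip G (u *m Dmat G Om) v = \sum_i e i * om Om u (f i) * om Om v (f i).
Proof.
rewrite /Dmat mulmxN ipNl mulmxA Smat_ip omE ip_skew// -omE -Smat_ip opprK.
by rewrite frame_ip; apply: eq_bigr => i _; rewrite !Smat_ip -!mulrA [X in _ * X]mulrC.
Qed.

Lemma Smat_trace : \tr (Smat G Om *m Smat G Om) =
  - \sum_i \sum_j e i * e j * om Om (f i) (f j) ^+ 2.
Proof.
transitivity (\sum_k (bvec R k *m (Smat G Om *m Smat G Om)) 0 k).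
  by apply: eq_bigr => k _; rewrite -rowE [RHS]mxE.
rewrite (frame_trace (phi := fun x => x *m (Smat G Om *m Smat G Om))); last first.
  by move=> a x y; rewrite mulmxDl scalemxAl.
rewrite -sumrN; apply: eq_bigr => i _.
have -> : Smat G Om *m Smat G Om = - Dmat G Om by rewrite opprK.
rewrite mulmxN ipNl Dmat_ip mulrN mulr_sumr; congr (- _); apply: eq_bigr => j _.
ring.
Qed.

Lemma quasi_einstein1_frame lam : quasi_einstein1 c G Om lam <->
  [/\ forall u, center c u -> (forall v, om Om u v = 0) -> u = 0,
   forall u v,
    - 2^-1 * (\sum_k e k * ip G (lbr c u (f k)) (lbr c v (f k))) +
    4^-1 * (\sum_k \sum_l e k * e l *
       (ip G (lbr c (f k) (f l)) u * ip G (lbr c (f k) (f l)) v)) =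
    lam * ip G u v + 2^-1 * \sum_k e k * om Om u (f k) * om Om v (f k) &
   \sum_k \sum_l e k * e l * om Om (f k) (f l) ^+ 2 = 4 * lam].
Proof.
rewrite /quasi_einstein1 Smat_trace; split=> -[inj].
  move=> [ric tr]; split=> // [u v|]; last lra.
  by rewrite -ric_form_frame -Ric_ip ric ip_lin_l ipZl Dmat_ip.
move=> ric tr; split=> //; split=> [u|]; last lra.
by apply: ip_ext => v; rewrite Ric_ip ric_form_frame ric ip_lin_l ipZl Dmat_ip.
Qed.

End FrameTheory.

(** * Structure constants *)

Section StructureConstants.
Variables (R : realType) (I : finType) (h : I -> R) (b : I -> I -> I -> R).
Variables (B : I -> I -> R) (lam : R) (o : I).
Hypothesis bA : forall u v k, b u v k = - b v u k.
Hypothesis bC : forall u v k, b u v k + b v k u + b k u v = 0.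
Hypothesis b0 : forall u v k, h k = 0 -> b u v k = 0.
Hypothesis E1 : forall k, \sum_u \sum_v b u v k ^+ 2 = 4 * lam * h k + 2 * h k ^+ 2.
(** Division by zero returns zero, so null eigenvalues contribute nothing to the sum, in agreement
    with [b0]. *)
Hypothesis E2 : forall u,
  \sum_v \sum_k b u v k ^+ 2 / h k + 2 * lam + h u + \sum_k B u k ^+ 2 = 0.
Hypothesis BH : forall u k, h u != 0 -> B u k = 0.
Hypothesis E3 : 2 * (\sum_u h u) + \sum_u \sum_k B u k ^+ 2 = 4 * lam.
Hypothesis lam_ge0 : 0 <= lam.
Hypothesis ho : h o < 0.
Hypothesis ho_unique : forall u, h u < 0 -> u = o.

(** * Trace identities and bounds on the eigenvalues *)

Lemma h_ge0 u : u != o -> 0 <= h u.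
Proof. by rewrite leNgt; apply: contra_neqN => /ho_unique. Qed.

(** [E1] divided by [h k] and summed over [k], and [E2] summed over [u], contain the same triple sum
    of [b^2 / h]. Eliminating it, and then the [B] terms by [E3], leaves a relation between the
    trace and [lam] alone. *)
Lemma sum_h : exists2 N : R, 0 <= N & \sum_u h u = - (4 * N + 4) * lam.
Proof.
(* Each summand is 1 or 0, so this counts the nonzero eigenvalues. *)
pose N := \sum_k h k / h k.
have N0 : 0 <= N.
  by apply: sumr_ge0 => k _; have [->|k0] := eqVneq (h k) 0; rewrite ?mul0r// divff.
have t1 : \sum_k \sum_u \sum_v b u v k ^+ 2 / h k = 4 * lam * N + 2 * \sum_u h u.
  rewrite /N !mulr_sumr -big_split; apply: eq_bigr => k _ /=.
  transitivity ((\sum_u \sum_v b u v k ^+ 2) / h k).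
    by rewrite mulr_suml; apply: eq_bigr => u _; rewrite mulr_suml.
  rewrite E1; have [->|k0] := eqVneq (h k) 0; first by rewrite invr0; ring.
  by field.
have t2 : \sum_u (\sum_v \sum_k b u v k ^+ 2 / h k + 2 * lam + h u +
            \sum_k B u k ^+ 2) = 0 by apply: big1 => u _; exact: E2.
move: t2; rewrite !big_split /= sumr_const -[_ *+ #|_|]mulr_natr.
set q := #|_|%:R; have q0 : 0 <= q :> R by rewrite ler0n.
have -> : \sum_u \sum_v \sum_k b u v k ^+ 2 / h k =
          \sum_k \sum_u \sum_v b u v k ^+ 2 / h k.
  rewrite [RHS]exchange_big; apply: eq_bigr => u _.
  by rewrite exchange_big.
(* The [q / 2] accounts for the constant [2 * lam], which occurs once in [E2] for each of the [q]
   indices. *)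
rewrite t1 => t2; exists (N + q / 2); last first.
  by move: (E3) t2; move: (\sum_u h u) (\sum_i \sum_k _); clearbody N q => H BB *; lra.
by rewrite addr_ge0// divr_ge0.
Qed.

Lemma sum_h_le0 : \sum_u h u <= 0.
Proof. have [N N0 ->] := sum_h; rewrite mulNr oppr_le0 mulr_ge0//; lra. Qed.

Lemma sum_h_eq0 : \sum_u h u = 0 -> lam = 0.
Proof.
have [N N0 ->] := sum_h => /eqP; rewrite mulf_eq0 => /orP[/eqP|/eqP//]; lra.
Qed.

Lemma h_le k : k != o -> h k <= - h o.
Proof.
move=> ko; have := sum_h_le0; rewrite (bigD1 o)//= (bigD1 k)//=.
suff : 0 <= \sum_(i | (i != o) && (i != k)) h i by lra.
by apply: sumr_ge0 => i /andP[/h_ge0].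
Qed.

Lemma h_add_le j k : j != o -> k != o -> j != k -> h j + h k <= - h o.
Proof.
move=> jo ko jk; have := sum_h_le0; rewrite (bigD1 o)//= (bigD1 j)//=.
rewrite (bigD1 k) /=; last by rewrite ko eq_sym.
suff : 0 <= \sum_(i | (i != o) && (i != j) && (i != k)) h i by lra.
by apply: sumr_ge0 => i /andP[/andP[/h_ge0]].
Qed.

(* Any weight strictly between -1 and -1/2 would do for the timelike index. *)
Definition wt u : R := if 0 < h u then 1 else if h u < 0 then - (3 / 4) else 0.

(** The cyclic sum collects the three entries linked by [bC]; only after this symmetrisation do the
    weighted terms acquire a sign. *)
Definition cycsq i j k : R :=
  b i j k ^+ 2 / h k + b j k i ^+ 2 / h i + b k i j ^+ 2 / h j.

(** By [E2], the weights on [i] and on [j] each give minus the sum of [wt u * (2 * lam + h u)]; by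
    [E1], the weight on [k] gives twice that sum. The [B] terms disappear because [wt u] vanishes at
    null indices and [B u] at the others. *)
Lemma weighted_sum :
  \sum_i \sum_j \sum_k (wt i + wt j + wt k) * (b i j k ^+ 2 / h k) = 0.
Proof.
pose F i j k := b i j k ^+ 2 / h k.
have s1 : \sum_i \sum_j \sum_k wt i * F i j k = - \sum_i wt i * (2 * lam + h i).
  rewrite -sumrN; apply: eq_bigr => i _.
  transitivity (wt i * \sum_j \sum_k F i j k).
    by rewrite mulr_sumr; apply: eq_bigr => j _; rewrite mulr_sumr.
  have [hi|hi] := eqVneq (h i) 0; first by rewrite /wt hi ltxx !mul0r oppr0.
  have := E2 i; rewrite [X in _ + X]big1 => [|k _]; last by rewrite BH// expr0n.
  by rewrite /F => e; rewrite -mulrN; congr (_ * _); lra.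
have s2 : \sum_i \sum_j \sum_k wt j * F i j k = - \sum_i wt i * (2 * lam + h i).
  rewrite -s1 exchange_big; apply: eq_bigr => i _; apply: eq_bigr => j _.
  by apply: eq_bigr => k _; rewrite /F bA sqrrN.
have s3 : \sum_i \sum_j \sum_k wt k * F i j k = 2 * \sum_i wt i * (2 * lam + h i).
  transitivity (\sum_k \sum_i \sum_j wt k * F i j k).
    rewrite [RHS]exchange_big; apply: eq_bigr => i _.
    by rewrite exchange_big.
  rewrite mulr_sumr; apply: eq_bigr => k _.
  transitivity (wt k / h k * \sum_i \sum_j b i j k ^+ 2).
    rewrite mulr_sumr; apply: eq_bigr => i _; rewrite mulr_sumr; apply: eq_bigr => j _.
    by rewrite /F; ring.
  rewrite E1; have [hk|hk] := eqVneq (h k) 0; first by rewrite /wt hk ltxx; ring.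
  by field.
transitivity (\sum_i \sum_j \sum_k wt i * F i j k + \sum_i \sum_j \sum_k wt j * F i j k
   + \sum_i \sum_j \sum_k wt k * F i j k); last by rewrite s1 s2 s3; ring.
rewrite -!big_split; apply: eq_bigr => i _; rewrite -!big_split; apply: eq_bigr => j _.
by rewrite -!big_split; apply: eq_bigr => k _ /=; rewrite /F; ring.
Qed.

Lemma cycsq_sum : \sum_i \sum_j \sum_k (wt i + wt j + wt k) * cycsq i j k = 0.
Proof.
pose T i j k := (wt i + wt j + wt k) * (b i j k ^+ 2 / h k).
have T0 : \sum_i \sum_j \sum_k T i j k = 0 := weighted_sum.
have T1 : \sum_i \sum_j \sum_k T j k i = 0.
  by rewrite -[RHS]T0 exchange_big; apply: eq_bigr => j _; rewrite exchange_big.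
have T2 : \sum_i \sum_j \sum_k T k i j = 0.
  rewrite -[RHS]T0 [RHS]exchange_big; apply: eq_bigr => i _.
  by rewrite exchange_big.
transitivity (\sum_i \sum_j \sum_k T i j k + \sum_i \sum_j \sum_k T j k i
   + \sum_i \sum_j \sum_k T k i j); last by rewrite T0 T1 T2 !addr0.
rewrite -!big_split; apply: eq_bigr => i _; rewrite -!big_split; apply: eq_bigr => j _.
by rewrite -!big_split; apply: eq_bigr => k _ /=; rewrite /T /cycsq; ring.
Qed.

Lemma wt_pos u : 0 < h u -> wt u = 1.
Proof. by rewrite /wt => ->. Qed.
Lemma wt_zero u : h u = 0 -> wt u = 0.
Proof. by rewrite /wt => ->; rewrite ltxx. Qed.
Lemma wt_o : wt o = - (3 / 4).
Proof. by rewrite /wt ho ltNge ltW. Qed.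
Lemma wt_ge0 u : u != o -> 0 <= wt u.
Proof.
move=> /h_ge0; rewrite le_eqVlt => /orP[/eqP/esym/wt_zero->//|/wt_pos->]; exact: ler01.
Qed.
Lemma wt_le1 u : wt u <= 1.
Proof. by rewrite /wt; case: ifP => // _; case: ifP => _; lra. Qed.

Lemma b_alt j k : b j j k = 0.
Proof. by have := bA j j k; lra. Qed.

Lemma sq_div_ge0 x a : 0 <= a -> 0 <= x ^+ 2 / a :> R.
Proof. by move=> a0; rewrite mulr_ge0 ?sqr_ge0 ?invr_ge0. Qed.

(* The weighted Cauchy-Schwarz inequality behind the (o,+,+) triples. *)
Lemma sq_div_add (x y p q r : R) : 0 < p -> 0 < q -> 0 < r ->
  x ^+ 2 / p + y ^+ 2 / q - (x + y) ^+ 2 / r =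
  ((x ^+ 2 * q + y ^+ 2 * p) * (r - p - q) + (x * q - y * p) ^+ 2) / (p * q * r).
Proof. by move=> p0 q0 r0; field; rewrite !gt_eqF. Qed.

Lemma cycsq_rot i j k : cycsq i j k = cycsq j k i.
Proof. by rewrite /cycsq; ring. Qed.

Lemma cycsq_ooo k : (wt o + wt o + wt k) * cycsq o o k =
  (2 * wt o + wt k) * (2 * b o k o ^+ 2 / h o).
Proof. by rewrite /cycsq b_alt (bA k o o); ring. Qed.

Lemma cycsq_o j k : j != o -> k != o -> j != k -> cycsq o j k =
  b o j k ^+ 2 / h k + b o k j ^+ 2 / h j - (b o j k - b o k j) ^+ 2 / (- h o).
Proof.
move=> jo ko jk; rewrite /cycsq.
have -> : b j k o = b o k j - b o j k by have := bC o j k; rewrite (bA k o j); lra.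
by rewrite (bA k o j) sqrrN invrN; ring.
Qed.

(** With a second [o] among the indices, weight and cyclic sum are both nonpositive. With a single
    [o], a nonnegative cyclic sum follows from [h_add_le] or [h_le], and the weight is positive
    unless [j] and [k] are both null. *)
Lemma wt_cycsq_ge0_o j k : 0 <= (wt o + wt j + wt k) * cycsq o j k.
Proof.
have ho0 : 0 < - h o by rewrite oppr_gt0.
have nonpos x : x ^+ 2 / h o <= 0.
  by rewrite mulr_ge0_le0 ?sqr_ge0// invr_le0 ltW.
have [->|jo] := eqVneq j o.
  rewrite cycsq_ooo -mulrA; have := nonpos (b o k o); have := wt_le1 k; rewrite wt_o; nra.
have [->|ko] := eqVneq k o.
  rewrite /cycsq b_alt (bA o j o) sqrrN expr0n mul0r addr0.
  have := nonpos (b j o o); have := wt_le1 j; rewrite wt_o; nra.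
have [->|jk] := eqVneq j k.
  rewrite /cycsq b_alt (bA o k k) sqrrN expr0n mul0r addr0 -mulr2n -mulr_natl.
  have [k0|k0] := eqVneq (h k) 0; first by rewrite (b0 _ _ k0) expr0n mul0r !mulr0.
  have k1 : 0 < h k by rewrite lt_def k0 h_ge0.
  rewrite wt_o (wt_pos k1); have := sq_div_ge0 (b k o k) (ltW k1); nra.
rewrite cycsq_o//.
have jkle := h_add_le jo ko jk.
have := h_ge0 jo; rewrite le_eqVlt => /orP[/eqP/esym j0|j1].
  (* For null [j] only [b o j k] survives, and the sign is that of [1 / h k - 1 / (- h o)]. *)
  rewrite j0 invr0 (b0 o k j0) subr0 expr0n mul0r addr0 wt_o (wt_zero j0).
  have := h_ge0 ko; rewrite le_eqVlt => /orP[/eqP/esym k0|k1].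
    by rewrite (b0 o j k0) expr0n !mul0r subr0 mulr0.
  rewrite (wt_pos k1) -mulrBr; apply: mulr_ge0; first lra.
  by rewrite mulr_ge0 ?sqr_ge0// subr_ge0 lef_pV2// h_le.
have := h_ge0 ko; rewrite le_eqVlt => /orP[/eqP/esym k0|k1].
  rewrite k0 invr0 (b0 o j k0) sub0r sqrrN expr0n mul0r add0r wt_o (wt_zero k0).
  rewrite (wt_pos j1) -mulrBr; apply: mulr_ge0; first lra.
  by rewrite mulr_ge0 ?sqr_ge0// subr_ge0 lef_pV2// h_le.
rewrite wt_o (wt_pos j1) (wt_pos k1); apply: mulr_ge0; first lra.
(* Here [y = - b o k j], [p = h k], [q = h j] and [r = - h o], so [r - p - q] is nonnegative by
   [jkle]. *)
rewrite -[b o k j ^+ 2]sqrrN sq_div_add//.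
apply: divr_ge0; last by rewrite !mulr_ge0// ltW.
rewrite addr_ge0 ?sqr_ge0//; apply: mulr_ge0; last lra.
by rewrite addr_ge0// mulr_ge0 ?sqr_ge0// ltW.
Qed.

Lemma wt_cycsq_ge0 i j k : 0 <= (wt i + wt j + wt k) * cycsq i j k.
Proof.
have [->|io] := eqVneq i o; first exact: wt_cycsq_ge0_o.
have [->|jo] := eqVneq j o.
  by rewrite cycsq_rot (addrC (wt i)) addrAC; exact: wt_cycsq_ge0_o.
have [->|ko] := eqVneq k o.
  by rewrite -cycsq_rot addrC addrA; exact: wt_cycsq_ge0_o.
by rewrite mulr_ge0 ?addr_ge0 ?wt_ge0// ?sq_div_ge0 ?h_ge0.
Qed.

(** * Equality cases *)

Lemma wt_cycsq_eq0 i j k : (wt i + wt j + wt k) * cycsq i j k = 0.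
Proof.
have p3 i' : 0 <= \sum_j \sum_k (wt i' + wt j + wt k) * cycsq i' j k.
  by apply: sumr_ge0 => j' _; apply: sumr_ge0 => k' _; exact: wt_cycsq_ge0.
have e1 := psumr_eq0P (fun i _ => p3 i) cycsq_sum (i := i) isT.
have p2 j' : 0 <= \sum_k (wt i + wt j' + wt k) * cycsq i j' k.
  by apply: sumr_ge0 => k' _; exact: wt_cycsq_ge0.
have e2 := psumr_eq0P (fun j _ => p2 j) e1 (i := j) isT.
exact: (psumr_eq0P (fun k _ => wt_cycsq_ge0 i j k) e2 (i := k) isT).
Qed.

Lemma b_spacelike i j k : i != o -> j != o -> k != o -> b i j k = 0.
Proof.
move=> io jo ko; have := h_ge0 ko; rewrite le_eqVlt => /orP[/eqP/esym/b0//|k1].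
have := wt_cycsq_eq0 i j k; rewrite (wt_pos k1) => /eqP; rewrite mulf_eq0.
have wi := wt_ge0 io; have wj := wt_ge0 jo.
rewrite (gt_eqF (_ : 0 < wt i + wt j + 1)) /=; last lra.
rewrite /cycsq -addrA paddr_eq0 ?addr_ge0 ?sq_div_ge0 ?h_ge0// => /andP[+ _].
by rewrite mulf_eq0 invr_eq0 (gt_eqF k1) orbF sqrf_eq0 => /eqP.
Qed.

Lemma b_oko k : b o k o = 0.
Proof.
have := wt_cycsq_eq0 o o k; rewrite cycsq_ooo => /eqP; rewrite mulf_eq0.
have wk := wt_le1 k; rewrite wt_o (lt_eqF (_ : 2 * - (3 / 4) + wt k < 0)) /=; last lra.
by rewrite !mulf_eq0 invr_eq0 (lt_eqF ho) orbF pnatr_eq0 /= orbb => /eqP.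
Qed.

Lemma b_okk k : b o k k = 0.
Proof.
have [->|ko] := eqVneq k o; first exact: b_alt.
have := h_ge0 ko; rewrite le_eqVlt => /orP[/eqP/esym/b0//|k1].
have := wt_cycsq_eq0 o k k; rewrite wt_o (wt_pos k1) /cycsq b_alt (bA k o k) sqrrN.
rewrite expr0n mul0r addr0 => e.
have /eqP : b o k k ^+ 2 / h k = 0 by lra.
by rewrite mulf_eq0 invr_eq0 (gt_eqF k1) orbF sqrf_eq0 => /eqP.
Qed.

(** Equality in [sq_div_add]: both nonnegative parts of the numerator vanish. The first gives
    [h j + h k = - h o], its other factor being positive as [b o j k] is nonzero; the second is the
    proportionality. For null [j] the two fractions are compared directly. *)
Lemma b_ojk j k : j != o -> k != o -> j != k -> b o j k != 0 ->
  h j + h k = - h o /\ b o j k * h j + b o k j * h k = 0.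
Proof.
move=> jo ko jk x0.
have ho0 : 0 < - h o by rewrite oppr_gt0.
have hk0 : h k != 0 by apply: contra_neq x0 => /b0.
have k1 : 0 < h k by rewrite lt_def hk0 h_ge0.
have jkle := h_add_le jo ko jk.
have := wt_cycsq_eq0 o j k; rewrite cycsq_o// wt_o (wt_pos k1) => /eqP.
rewrite mulf_eq0 => /orP[|].
  have := h_ge0 jo; rewrite le_eqVlt => /orP[/eqP/esym/wt_zero->|/wt_pos->] /eqP; lra.
have := h_ge0 jo; rewrite le_eqVlt => /orP[/eqP/esym j0|j1].
  rewrite j0 invr0 (b0 o k j0) subr0 expr0n !mul0r addr0 -mulrBr mulf_eq0 sqrf_eq0.
  rewrite (negPf x0) /= subr_eq0 => /eqP/invr_inj; rewrite mulr0; lra.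
rewrite -[b o k j ^+ 2]sqrrN sq_div_add// mulf_eq0 invr_eq0.
rewrite (gt_eqF (mulr_gt0 (mulr_gt0 k1 j1) ho0)) orbF.
rewrite paddr_eq0 ?sqr_ge0//; last first.
  apply: mulr_ge0; last lra.
  by rewrite addr_ge0// mulr_ge0 ?sqr_ge0// ltW.
have x2 : 0 < b o j k ^+ 2 by rewrite exprn_even_gt0.
case/andP; rewrite mulf_eq0 => /orP[/eqP e|/eqP e] /eqP/eqP; rewrite sqrf_eq0 => /eqP.
  have := sqr_ge0 (b o k j); rewrite -[(- _) ^+ 2]sqrrN opprK in e; nra.
by split; lra.
Qed.

Lemma sum_three (V : nmodType) (F : I -> V) i j k : i != j -> i != k -> j != k ->
  (forall u, [\/ u = i, u = j | u = k]) -> \sum_u F u = F i + F j + F k.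
Proof.
move=> ij ik jk ex; rewrite (bigD1 i)//= (bigD1 j) 1?eq_sym//= (bigD1 k) /=; last first.
  by rewrite eq_sym ik eq_sym.
rewrite big1 ?addr0 ?addrA// => u /andP[/andP[ui uj] uk].
by have [e|e|e] := ex u; move: ui uj uk; rewrite e eqxx.
Qed.

(** The second premise says that no nonzero combination of the [y_u] is central; it is what limits
    the indices to three. *)
Theorem structure_constants :
  (exists u v k, b u v k != 0) ->
  (forall x : I -> R, (forall v k, \sum_u x u * b u v k = 0) -> forall u, x u = 0) ->
  lam = 0 /\ (forall u k, B u k = 0) /\
  exists j k s,
    [/\ [/\ o != j, o != k, j != k & forall u, [\/ u = o, u = j | u = k]],
        [/\ 0 <= h j, 0 < h k & h j + h k = - h o],
        s = 1 \/ s = -1,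
        [/\ b o j k = s * h k, b o k j = - (s * h j) & b j k o = s * h o] &
        [/\ forall i, b o i o = 0, forall i, b o i i = 0, b j k j = 0 & b j k k = 0]].
Proof.
move=> [u0 [v0 [k0 nz]]] nondeg.
have [j [k [jo ko jk x0]]] : exists j k, [/\ j != o, k != o, j != k & b o j k != 0].
  (* If the last index of a nonzero entry differs from [o], one of the first two equals [o], and
     antisymmetry puts it first. A nonzero entry with last index [o] is first rotated by [bC]. *)
  have gen u v w : b u v w != 0 -> w != o -> exists j k, [/\ j != o, k != o, j != k & b o j k != 0].
    move=> bn wo; have [uo|uo] := eqVneq u o.
      exists v, w; split=> //; last by rewrite -uo.
        by apply: contra_neq bn => ->; rewrite uo b_alt.
      by apply: contra_neq bn => ->; rewrite uo b_okk.
    have [vo|vo] := eqVneq v o; last by rewrite b_spacelike ?eqxx in bn.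
    exists u, w; split=> //; last by rewrite -vo bA oppr_eq0.
    by apply: contra_neq bn => ->; rewrite bA vo b_okk oppr0.
  have [ko|ko] := eqVneq k0 o; last exact: gen nz ko.
  have [uo|uo] := eqVneq u0 o; first by rewrite ko uo b_oko eqxx in nz.
  have [vo|vo] := eqVneq v0 o; first by rewrite ko vo bA b_oko oppr0 eqxx in nz.
  have [b1|b1] := eqVneq (b v0 k0 u0) 0; last exact: gen b1 uo.
  apply: (gen k0 u0 v0) => //; apply: contra_neq nz => b2.
  by have := bC u0 v0 k0; rewrite b1 b2 !addr0.
have [hjk xy] := b_ojk jo ko jk x0.
have hk1 : 0 < h k.
  by rewrite lt_def h_ge0// andbT; apply: contra_neq x0 => /b0.
have hj0 := h_ge0 jo.
(* Since [h o], [h j] and [h k] cancel, the trace is the sum of the other eigenvalues, which are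
   nonnegative. The trace being nonpositive, they all vanish, and so does [lam]. *)
have rest_ge0 : 0 <= \sum_(i | (i != o) && (i != j) && (i != k)) h i.
  by apply: sumr_ge0 => i /andP[/andP[/h_ge0]].
have sum_split : \sum_u h u = \sum_(i | (i != o) && (i != j) && (i != k)) h i.
  rewrite (bigD1 o)//= (bigD1 j)//= (bigD1 k) /=; last by rewrite ko eq_sym.
  lra.
have rest0 : \sum_(i | (i != o) && (i != j) && (i != k)) h i = 0.
  by have := sum_h_le0; lra.
have lam0 : lam = 0 by apply: sum_h_eq0; lra.
have hN i : i != o -> i != j -> i != k -> h i = 0.
  move=> io ij ik; apply: (psumr_eq0P _ rest0 (i := i)); last by rewrite io ij ik.
  by move=> i' /andP[/andP[/h_ge0]].
(* For null [n] the array [b n] is a multiple of one fixed array supported at [(o, k)] and [(k, o)],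
   so any two null indices are linearly dependent. *)
have bN n : h n = 0 -> forall v w, b n v w =
    - b o n k * (((v == o) && (w == k)) || ((v == k) && (w == o)))%:R.
  move=> hn v w.
  have no : n != o by apply: contraTneq ho => <-; rewrite hn ltxx.
  have onj : b o n j = 0.
    have [nj|nj] := eqVneq n j; first by rewrite nj b_okk.
    by have [//|/(b_ojk no jo nj)[]] := eqVneq (b o n j) 0; lra.
  have bno v' : b n v' o = b o v' n - b o n v' by have := bC o n v'; rewrite (bA v' o n); lra.
  have [wo|wo] := eqVneq w o.
    rewrite wo bno (b0 _ _ hn) [o == k]eq_sym (negPf ko) andbF andbT orFb sub0r.
    have [->|vk] := eqVneq v k; first by rewrite mulr1.
    rewrite mulr0; have [->|vo] := eqVneq v o; first by rewrite b_oko oppr0.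
    have [->|vj] := eqVneq v j; first by rewrite onj oppr0.
    by rewrite (b0 _ _ (hN _ vo vj vk)) oppr0.
  rewrite andbF orbF; have [vo|vo] := eqVneq v o; last first.
    by rewrite b_spacelike// mulr0.
  rewrite vo andTb bA; have [->|wk] := eqVneq w k; first by rewrite mulr1.
  have [->|wj] := eqVneq w j; first by rewrite onj mulr0 oppr0.
  by rewrite (b0 _ _ (hN _ wo wj wk)) mulr0 oppr0.
have ex u : [\/ u = o, u = j | u = k].
  have [->|uo] := eqVneq u o; first by constructor 1.
  have [->|uj] := eqVneq u j; first by constructor 2.
  have [->|uk] := eqVneq u k; first by constructor 3.
  (* A fourth index [u] is null. If [h j] is nonzero then [b u] vanishes, since [b_ojk] would force
     [h k = - h o]; otherwise [j] is null too and [b j], [b u] are dependent. Either way [nondeg] is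
     contradicted. *)
  exfalso; have hu := hN _ uo uj uk.
  have delta (F : I -> R) i : \sum_u (u == i)%:R * F u = F i.
    rewrite (bigD1 i)//= eqxx mul1r big1 ?addr0// => i' /negPf->.
    by rewrite mul0r.
  have [hj|hj] := eqVneq (h j) 0; last first.
    have ouk : b o u k = 0.
      by have [//|/(b_ojk uo ko uk)[]] := eqVneq (b o u k) 0; move/eqP: hj; lra.
    have bu v w : \sum_i (i == u)%:R * b i v w = 0.
      by rewrite delta (bN _ hu) ouk oppr0 mul0r.
    by have /eqP := nondeg _ bu u; rewrite eqxx oner_eq0.
  have bu v w : \sum_i (b o u k * (i == j)%:R - b o j k * (i == u)%:R) * b i v w = 0.
    under eq_bigr do rewrite mulrBl -!mulrA.
    by rewrite sumrB -!mulr_sumr !delta (bN _ hj) (bN _ hu); ring.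
  have /eqP := nondeg _ bu u.
  by rewrite eqxx (negPf uj) mulr0 sub0r mulr1 oppr_eq0 (negPf x0).
split=> //; split.
  move=> u v; have := E3; rewrite lam0 sum_split rest0 mulr0 add0r mulr0 => BB.
  have p1 i : 0 <= \sum_k B i k ^+ 2 by apply: sumr_ge0 => k' _; exact: sqr_ge0.
  have e1 := psumr_eq0P (fun i _ => p1 i) BB (i := u) isT.
  apply/eqP; rewrite -sqrf_eq0.
  by rewrite (psumr_eq0P (fun i _ => sqr_ge0 (B u i)) e1 (i := v) isT).
have oj : o != j by rewrite eq_sym.
have ok : o != k by rewrite eq_sym.
(* [E1] at [o], where only the entries [(j, k)] and [(k, j)] remain; the sign in the square root is
   [s]. *)
have z2 : b j k o ^+ 2 = h o ^+ 2.
  have := E1 o; rewrite lam0 (sum_three _ oj ok jk ex) !(sum_three _ oj ok jk ex).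
  rewrite !b_alt !b_oko (bA j o o) (bA k o o) !b_oko oppr0 (bA k j o) sqrrN !expr0n /=; lra.
have zE : b j k o = b o k j - b o j k by have := bC o j k; rewrite (bA k o j); lra.
have [s [sE zs]] : exists s : R, (s = 1 \/ s = -1) /\ b j k o = s * h o.
  move/eqP: z2; rewrite eqf_sqr => /orP[/eqP->|/eqP->].
    by exists 1; split; [left|rewrite mul1r].
  by exists (-1); split; [right|rewrite mulN1r].
(* [zE] and [xy] form a linear system for [b o j k] and [b o k j] with determinant [h j + h k], up
   to sign, which is nonzero. *)
have xE : b o j k = s * h k.
  have : b o j k * (h j + h k) = s * h k * (h j + h k).
    have -> : b o j k * (h j + h k) = (b o j k * h j + b o k j * h k) - h k * b j k o.
      rewrite zE; ring.
    by rewrite xy zs hjk; ring.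
  by apply: mulIf; rewrite hjk oppr_eq0 lt_eqF.
exists j, k, s; split=> //.
  split=> //; have -> : b o k j = b j k o + b o j k by lra.
  by rewrite zs xE (_ : h o = - (h j + h k)); [ring|lra].
by split=> *; rewrite ?b_oko ?b_okk ?b_spacelike.
Qed.

End StructureConstants.

(** * Adapted bases *)

Definition eps {R : realType} {k : nat} (i : 'I_k.+1) : R := if i == ord0 then -1 else 1.

Lemma eps_sq {R : realType} {k : nat} (i : 'I_k.+1) : eps i * eps i = 1 :> R.
Proof. by rewrite /eps; case: ifP; rewrite ?mulrNN mulr1. Qed.

Lemma lorentzian_basis {R : realType} {n : nat} (G : 'M[R]_n) (W : 'rV[R]_n -> Prop) :
  lorentzian_on G W -> exists (k : nat) (f : 'I_k.+1 -> 'rV[R]_n),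
    [/\ forall i, W (f i), forall i j, ip G (f i) (f j) = (i == j)%:R * eps i &
        forall u, W u -> u = \sum_i (eps i * ip G u (f i)) *: f i].
Proof.
move=> [k [f [Wf [_ [span orth]]]]]; exists k, f.
have orth' i j : ip G (f i) (f j) = (i == j)%:R * eps i.
  by rewrite orth /eps; case: (i == j); rewrite ?mul1r ?mul0r.
split=> // u /span[a ->]; apply: eq_bigr => i _; congr (_ *: _).
rewrite ip_suml (bigD1 i)//= big1 ?addr0 => [|j /negPf ji].
  by rewrite ipZl orth' eqxx mul1r mulrCA eps_sq mulr1.
by rewrite ipZl orth' ji mul0r mulr0.
Qed.

(* Reversed Cauchy-Schwarz: the orthogonal of a timelike vector is Euclidean. *)
Lemma timelike_orthogonal {R : realType} {n : nat} (G : 'M[R]_n) (u v : 'rV[R]_n) :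
  lorentzian_metric G -> ip G u u < 0 -> ip G u v = 0 -> v != 0 -> 0 < ip G v v.
Proof.
move=> [sG /lorentzian_basis[k [f [_ orth span]]]].
have fr : frame G eps f by move=> x; exact: span.
have ipE x w : ip G x w = \sum_i ip G x (f (lift ord0 i)) * ip G w (f (lift ord0 i))
                         - ip G x (f ord0) * ip G w (f ord0).
  rewrite (frame_ip sG fr) big_ord_recl /eps eqxx addrC; congr (_ + _); last by ring.
  by apply: eq_bigr => i _; rewrite mul1r.
rewrite (ipE u u) (ipE u v) (ipE v v); set a := ip G u (f ord0); set d := ip G v (f ord0) => uu uv v0.
pose ai i := ip G u (f (lift ord0 i)); pose di i := ip G v (f (lift ord0 i)).
have {}uu : \sum_i ai i ^+ 2 < a ^+ 2 by move: uu; rewrite subr_lt0.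
have {}uv : a * d = \sum_i ai i * di i by apply/esym/eqP; rewrite -subr_eq0 uv.
suff : d ^+ 2 < \sum_i di i ^+ 2 by rewrite subr_gt0.
(* By [uv] this sum equals [a^2 (D - d^2) + d^2 (A - a^2)], where [A] and [D] are the sums of [ai^2]
   and [di^2]. As [A < a^2], a nonzero [d] forces [D > d^2]. *)
have sq : 0 <= \sum_i (di i * a - ai i * d) ^+ 2.
  by apply: sumr_ge0 => i _; exact: sqr_ge0.
have sqE : \sum_i (di i * a - ai i * d) ^+ 2 =
    a ^+ 2 * \sum_i di i ^+ 2 - 2 * (a * d) * (\sum_i ai i * di i) + d ^+ 2 * \sum_i ai i ^+ 2.
  rewrite !mulr_sumr -sumrN -!big_split; apply: eq_bigr => i _ /=; ring.
move: sq; rewrite {}sqE -uv => sq.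
have A0 : 0 <= \sum_i ai i ^+ 2 by apply: sumr_ge0 => i _; exact: sqr_ge0.
have D0 : 0 <= \sum_i di i ^+ 2 by apply: sumr_ge0 => i _; exact: sqr_ge0.
have [d0|d0] := eqVneq d 0; last first.
  have d2 : 0 < d ^+ 2 by rewrite exprn_even_gt0.
  rewrite ltNge; apply/negP => le.
  have p1 : 0 <= a ^+ 2 * (d ^+ 2 - \sum_i di i ^+ 2) by rewrite mulr_ge0 ?sqr_ge0 ?subr_ge0.
  have p2 : 0 < d ^+ 2 * (a ^+ 2 - \sum_i ai i ^+ 2) by rewrite mulr_gt0 ?subr_gt0.
  move: p1 p2 sq; move: (\sum_i _) (\sum_i _) => D A p1 p2 sq; clear -p1 p2 sq; lra.
rewrite d0 expr0n lt_def D0 andbT; apply: contra_neq v0 => D1.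
rewrite (fr v) big1// => i _.
suff -> : ip G v (f i) = 0 by rewrite mulr0 scale0r.
case: (unliftP ord0 i) => [i'|] -> //.
apply/eqP; rewrite -sqrf_eq0; apply/eqP.
exact: (psumr_eq0P (fun i _ => sqr_ge0 (di i)) D1 (i := i') isT).
Qed.

Lemma mulmx_ip {R : realType} {n m p : nat} (G : 'M[R]_n) (X : 'M[R]_(m, n))
  (Y : 'M[R]_(p, n)) i j : (X *m G *m Y^T) i j = ip G (row i X) (row j Y).
Proof.
rewrite /ip -row_mul [LHS]mxE [RHS]mxE; apply: eq_bigr => k _.
by congr (_ * _); rewrite !mxE.
Qed.

(* An orthonormal basis of the orthogonal of the z i which diagonalises A A^*,
   where A is the part of the skew operator of Om going from span z to it. *)
Lemma adapted_basis {R : realType} {n p : nat} (G Om : 'M[R]_n) (z : 'I_p.+1 -> 'rV[R]_n) :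
  lorentzian_metric G -> (forall i j, ip G (z i) (z j) = (i == j)%:R * eps i) ->
  exists (q : nat) (y : 'I_q -> 'rV[R]_n) (h : 'I_q -> R),
  [/\ forall u v, ip G (y u) (y v) = (u == v)%:R,
      forall i u, ip G (z i) (y u) = 0,
      forall v, v = \sum_i (eps i * ip G v (z i)) *: z i + \sum_u ip G v (y u) *: y u &
      forall u v, \sum_i eps i * om Om (z i) (y u) * om Om (z i) (y v) = (u == v)%:R * h u].
Proof.
move=> LG orth; have [sG _] := LG.
pose Z := \matrix_i z i; pose N := G *m Z^T.
have rowZ i : row i Z = z i by rewrite rowK.
have kerN (v : 'rV_n) : (v *m N == 0) = [forall i, ip G v (z i) == 0].
  have vN i : (v *m N) 0 i = ip G v (z i) by rewrite /N mulmxA mulmx_ip rowZ row_id.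
  apply/eqP/forallP => [v0 i|v0]; first by rewrite -vN v0 mxE.
  by apply/rowP => i; rewrite vN (eqP (v0 i)) mxE.
pose q := \rank (kermx N).
(* By [kerN], the rows of [K] form a basis of the orthogonal of the [z i]; it is Euclidean because
   [z ord0] is timelike. *)
have [K [Kfree Keq]] : exists K : 'M_(q, n), row_free K /\ (K :=: kermx N)%MS.
  by exists (row_base (kermx N)); split; [exact: row_base_free|exact: eq_row_base].
have Kz (x : 'rV_q) i : ip G (x *m K) (z i) = 0.
  suff : (x *m K) *m N == 0 by rewrite kerN => /forallP/(_ i)/eqP.
  by apply/eqP/sub_kermxP; apply: (submx_trans (submxMl _ _)); rewrite Keq.
have pM : posdef (K *m G *m K^T).
  move=> x x0; have -> : x *m (K *m G *m K^T) *m x^T = (x *m K) *m G *m (x *m K)^T.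
    by rewrite trmx_mul !mulmxA.
  apply: (timelike_orthogonal (u := z ord0)) => //.
  - by rewrite orth eqxx mul1r /eps eqxx ltrN10.
  - by rewrite ip_sym// Kz.
  by rewrite mulmx_free_eq0.
pose E : 'M[R]_p.+1 := diag_mx (\row_i eps i).
have [A AE] : exists A, A = Z *m Om *m K^T by exists (Z *m Om *m K^T).
(* The second form is the Gram matrix, with the signs [eps], of the functionals given by [Om] on the
   [z i]; its diagonal entries become the [h u]. *)
have [||T [d [TM TH]]] := simultaneous_diagonalization _ _ pM (H := A^T *m E *m A).
- by rewrite !trmx_mul trmxK sG mulmxA.
- by rewrite !trmx_mul trmxK /E tr_diag_mx mulmxA.
pose Y := T *m K.
exists q, (fun u => row u Y), (fun u => d 0 u).
have YY : Y *m G *m Y^T = 1%:M by rewrite -TM /Y trmx_mul !mulmxA.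
have yy u v : ip G (row u Y) (row v Y) = (u == v)%:R by rewrite -mulmx_ip YY mxE.
have zy i u : ip G (z i) (row u Y) = 0 by rewrite ip_sym// row_mul Kz.
split=> // [v|u v].
  (* The part of [v] orthogonal to all [z i], hence in the row space of [K]. *)
  pose x := v - \sum_i (eps i * ip G v (z i)) *: z i.
  have xz i : ip G x (z i) = 0.
    rewrite /x ipBl ip_suml (bigD1 i)//= big1 => [|j /negPf ji]; last first.
      by rewrite ipZl orth ji mul0r mulr0.
    by rewrite ipZl orth eqxx mul1r mulrAC eps_sq mul1r addr0 subrr.
  have /submxP[a xa] : (x <= K)%MS.
    by rewrite Keq; apply/sub_kermxP/eqP; rewrite kerN; apply/forallP => i; rewrite xz.
  have Tu : T \in unitmx by move: TM; rewrite -mulmxA => /mulmx1_unit[].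
  have xY : x = \sum_u (a *m invmx T) 0 u *: row u Y.
    by rewrite -mulmx_sum_row /Y mulmxA mulmxKV.
  have vy u : ip G v (row u Y) = (a *m invmx T) 0 u.
    have -> : v = x + \sum_i (eps i * ip G v (z i)) *: z i by rewrite subrK.
    rewrite ipDl [X in _ + X]ip_suml [X in _ + X]big1 => [|i _]; last by rewrite ipZl zy mulr0.
    rewrite addr0 {1}xY ip_suml (bigD1 u)//= big1 => [|u' /negPf uu'].
      by rewrite ipZl yy eqxx mulr1 addr0.
    by rewrite ipZl yy uu' mulr0.
  rewrite [LHS](_ : v = \sum_i (eps i * ip G v (z i)) *: z i + x); last by rewrite addrC subrK.
  by congr (_ + _); rewrite xY; apply: eq_bigr => u _; rewrite vy.
have /matrixP/(_ u v) : (A *m T^T)^T *m E *m (A *m T^T) = diag_mx d.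
  by rewrite -TH trmx_mul trmxK !mulmxA.
rewrite [X in _ = X]mxE mulr_natl => <-.
have AT i w : (A *m T^T) i w = om Om (z i) (row w Y).
  by rewrite AE -mulmxA -trmx_mul mulmx_ip rowZ.
rewrite [RHS]mxE; apply: eq_bigr => i _.
rewrite -(AT i u) -(AT i v) /E mul_mx_diag; move: (A *m T^T) => X; rewrite !mxE; ring.
Qed.

(** * The two normal forms *)

(** Orthonormality makes the matrix of the [f i] row free and the frame property makes it row full,
    so it is square. This fixes the dimensions 5 and 6. *)
Lemma orthonormal_frame_size {R : realType} {n m : nat} (G : 'M[R]_n)
    (e : 'I_m -> R) (f : 'I_m -> 'rV[R]_n) :
  (forall i, e i * e i = 1) -> (forall i j, ip G (f i) (f j) = (i == j)%:R * e i) ->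
  frame G e f -> m = n.
Proof.
move=> ee orth fr; pose X := \matrix_i f i.
have /eqP <- : row_free X.
  apply/row_freeP; exists (G *m X^T *m diag_mx (\row_i e i)).
  rewrite !mulmxA; apply/matrixP => i j; rewrite mul_mx_diag mxE mulmx_ip !rowK orth !mxE.
  by case: eqP => [->|_]; rewrite ?mul1r ?mul0r ?ee.
suff /eqP : row_full X by [].
rewrite -sub1mx; apply/row_subP => k; rewrite (fr (row k 1%:M)).
have -> : \sum_i (e i * ip G (row k 1%:M) (f i)) *: f i =
    (\row_i (e i * ip G (row k 1%:M) (f i))) *m X.
  by rewrite mulmx_sum_row; apply: eq_bigr => i _; rewrite rowK mxE.
exact: submxMl.
Qed.

(** Orthonormality gives a right inverse of the square matrix of the [f i]; being also a left
    inverse, it yields the expansion. *)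
Lemma orthonormal_frame {R : realType} {n : nat} (G : 'M[R]_n) (f : 'I_n -> 'rV[R]_n) :
  Defs.orthonormal G f -> frame G (fun i => if val i == 0%N then -1 else 1) f.
Proof.
move=> orth v; pose e (i : 'I_n) : R := if val i == 0%N then -1 else 1.
pose X := \matrix_i f i.
have X1 : X *m (G *m X^T *m diag_mx (\row_i e i)) = 1%:M.
  rewrite !mulmxA; apply/matrixP => i j; rewrite mul_mx_diag mxE mulmx_ip !rowK orth !mxE.
  case: eqP => [->|_]; last by rewrite mul0r.
  by rewrite /e; case: eqP; rewrite ?mulrNN mulr1.
rewrite -{1}[v]mulmx1 -(mulmx1C X1) mulmxA mulmx_sum_row; apply: eq_bigr => i _.
rewrite rowK; congr (_ *: _); rewrite !mulmxA mul_mx_diag mxE mulmx_ip row_id rowK mxE.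
exact: mulrC.
Qed.

Section NormalForms.
Variables (R : realType) (n : nat) (c : 'I_n -> 'I_n -> 'rV[R]_n) (G Om : 'M[R]_n).
Hypotheses (sG : G^T = G) (lc : is_lie c) (sO : Om^T = - Om).
(** To be instantiated by the normalised [w_o, w_k, w_j] and by [y_o, y_j, y_k], in these orders,
    with [a0, a1, a2] the square roots of [|h_o|, |h_k|, |h_j|]. *)
Variables (g0 g1 g2 x0 x1 x2 : 'rV[R]_n) (s a0 a1 a2 : R).
Hypothesis hs : s = 1 \/ s = -1.
Hypotheses (g0c : center c g0) (g1c : center c g1) (g2c : center c g2).
Hypotheses (br01 : lbr c x0 x1 = (s * a1) *: g1)
  (br02 : lbr c x0 x2 = (- s * a2) *: g2) (br12 : lbr c x1 x2 = (s * a0) *: g0).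
Hypotheses (om_g0 : [/\ om Om g0 x0 = - a0, om Om g0 x1 = 0 & om Om g0 x2 = 0])
  (om_g1 : [/\ om Om g1 x0 = 0, om Om g1 x1 = 0 & om Om g1 x2 = a1])
  (om_g2 : [/\ om Om g2 x0 = 0, om Om g2 x1 = a2 & om Om g2 x2 = 0])
  (om_gg : [/\ om Om g0 g1 = 0, om Om g0 g2 = 0 & om Om g1 g2 = 0])
  (om_xx : [/\ om Om x0 x1 = 0, om Om x0 x2 = 0 & om Om x1 x2 = 0]).
Hypotheses (ip_x : [/\ ip G x0 x0 = 1, ip G x1 x1 = 1 & ip G x2 x2 = 1])
  (ip_xx : [/\ ip G x0 x1 = 0, ip G x0 x2 = 0 & ip G x1 x2 = 0])
  (ip_g0x : [/\ ip G g0 x0 = 0, ip G g0 x1 = 0 & ip G g0 x2 = 0])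
  (ip_g1x : [/\ ip G g1 x0 = 0, ip G g1 x1 = 0 & ip G g1 x2 = 0])
  (ip_g2x : [/\ ip G g2 x0 = 0, ip G g2 x1 = 0 & ip G g2 x2 = 0])
  (ip_gg : [/\ ip G g0 g1 = 0, ip G g0 g2 = 0 & ip G g1 g2 = 0])
  (ip_g01 : ip G g0 g0 = -1 /\ ip G g1 g1 = 1).
Hypothesis span : forall v, v =
  - ip G v g0 *: g0 + ip G v g1 *: g1 + ip G v g2 *: g2 +
  (ip G v x0 *: x0 + ip G v x1 *: x1 + ip G v x2 *: x2).
Hypotheses (a0_gt0 : 0 < a0) (a1_gt0 : 0 < a1).
Hypothesis a012 : a0 ^+ 2 = a1 ^+ 2 + a2 ^+ 2.

Let omN u v : om Om u v = - om Om v u. Proof. exact: ip_skew. Qed.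
Let omuu u : om Om u u = 0. Proof. by have := omN u u; lra. Qed.
Let ipS u v : ip G u v = ip G v u. Proof. exact: ip_sym. Qed.

Lemma case2_intro : ip G g2 g2 = 1 -> 0 < a2 -> case2 c G Om.
Proof.
move=> ip_g2 a2_gt0; pose l := [:: g0; g1; g2; x0; x1; x2].
have [ix0 ix1 ix2] := ip_x. have [ix01 ix02 ix12] := ip_xx.
have [i00 i01 i02] := ip_g0x. have [i10 i11 i12] := ip_g1x. have [i20 i21 i22] := ip_g2x.
have [ig01 ig02 ig12] := ip_gg. have [ig0 ig1] := ip_g01.
have [o00 o01 o02] := om_g0. have [o10 o11 o12] := om_g1. have [o20 o21 o22] := om_g2.
have [og01 og02 og12] := om_gg. have [ox01 ox02 ox12] := om_xx.
have orth (i j : nat) : (i < 6)%N -> (j < 6)%N -> ip G (nth 0 l i) (nth 0 l j) =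
    if i == j then (if i == 0%N then -1 else 1) else 0.
  by case: i => [|[|[|[|[|[|//]]]]]] _; case: j => [|[|[|[|[|[|//]]]]]] _ /=;
    first [done | assumption | by rewrite ipS].
have n6 : 6%N = n.
  apply: (@orthonormal_frame_size R n 6 G (fun i => if val i == 0%N then -1 else 1)
           (fun i => nth 0 l i)).
  - by move=> i; case: ifP => _; rewrite ?mulrNN mulr1.
  - by move=> i j; rewrite orth// -val_eqE; case: (val i == val j); rewrite ?mul1r ?mul0r.
  move=> v; rewrite !big_ord_recl big_ord0 /= {1}(span v) !mul1r mulN1r addr0.
  by rewrite !addrA.
(* The first three scalars are read off from the brackets; the value [- a0] of [om] on [g0, x0] then
   forces the last sign to be -1. *)
subst n; split=> //; exists (fun i => nth 0 l i), (s * a1), (- s * a2), s, (-1).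
have s2 : s * s = 1 by case: hs => ->; rewrite ?mulrNN mulr1.
have s0 : s != 0 by case: hs => ->; rewrite ?oppr_eq0 oner_eq0.
have -> : Num.sqrt ((s * a1) ^+ 2 + (- s * a2) ^+ 2) = a0.
  have -> : (s * a1) ^+ 2 + (- s * a2) ^+ 2 = a0 ^+ 2.
    by rewrite a012 !exprMn sqrrN expr2 s2 !mul1r.
  by rewrite sqrtr_sqr ger0_norm// ltW.
split; first by rewrite mulf_neq0// gt_eqF.
split; first by rewrite mulf_neq0 ?oppr_eq0// gt_eqF.
do 2 (split; first by [|right]).
split; first by move=> i j; rewrite orth// val_eqE.
have sum6 (F : nat -> 'rV[R]_6) : \sum_(k < 6) F k = F 0%N + F 1%N + F 2 + F 3 + F 4 + F 5.
  by rewrite !big_ord_recl big_ord0 /= addr0 !addrA.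
have cg x u : center c u -> lbr c x u = 0 by move=> cu; rewrite (lbr_skew lc) cu oppr0.
split.
  move=> i j; rewrite (sum6 (fun k => T2 _ _ _ _ i j k *: nth 0 l k)).
  case: i => [[|[|[|[|[|[|//]]]]]] ?]; case: j => [[|[|[|[|[|[|//]]]]]] ?] /=;
    rewrite ?scale0r ?addr0 ?add0r ?(g0c, g1c, g2c) ?(cg _ _ g0c) ?(cg _ _ g1c) ?(cg _ _ g2c)
      ?lbr_alt ?br01 ?br02 ?br12 //;
    by rewrite (lbr_skew lc) ?br01 ?br02 ?br12 scaleNr ?mulN1r.
move=> i j.
case: i => [[|[|[|[|[|[|//]]]]]] ?]; case: j => [[|[|[|[|[|[|//]]]]]] ?] /=;
  rewrite ?omuu //; first [assumption|rewrite omN ?o00 ?o01 ?o02 ?o10 ?o11 ?o12 ?o20 ?o21 ?o22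
     ?og01 ?og02 ?og12 ?ox01 ?ox02 ?ox12 ?oppr0 //|idtac];
  rewrite -?omN ?o00 ?o12 ?o21; first [by ring|by case: hs => ->; ring].
Qed.

Lemma case1_intro : g2 = 0 -> a2 = 0 -> case1 c G Om.
Proof.
move=> g20 a20; pose l := [:: g0; g1; x0; x1; x2].
have [ix0 ix1 ix2] := ip_x. have [ix01 ix02 ix12] := ip_xx.
have [i00 i01 i02] := ip_g0x. have [i10 i11 i12] := ip_g1x.
have [ig01 _ _] := ip_gg. have [ig0 ig1] := ip_g01.
have [o00 o01 o02] := om_g0. have [o10 o11 o12] := om_g1.
have [og01 _ _] := om_gg. have [ox01 ox02 ox12] := om_xx.
have a01 : a0 = a1.
  by apply/eqP; rewrite -(@eqrXn2 _ 2) ?ltW// a012 a20 expr0n addr0.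
have orth (i j : nat) : (i < 5)%N -> (j < 5)%N -> ip G (nth 0 l i) (nth 0 l j) =
    if i == j then (if i == 0%N then -1 else 1) else 0.
  by case: i => [|[|[|[|[|//]]]]] _; case: j => [|[|[|[|[|//]]]]] _ /=;
    first [done | assumption | by rewrite ipS].
have n5 : 5%N = n.
  apply: (@orthonormal_frame_size R n 5 G (fun i => if val i == 0%N then -1 else 1)
           (fun i => nth 0 l i)).
  - by move=> i; case: ifP => _; rewrite ?mulrNN mulr1.
  - by move=> i j; rewrite orth// -val_eqE; case: (val i == val j); rewrite ?mul1r ?mul0r.
  move=> v; rewrite !big_ord_recl big_ord0 /= {1}(span v) g20 scaler0 !mul1r mulN1r !addr0.
  by rewrite !addrA.
subst n; split=> //; exists (fun i => nth 0 l i), (s * a1), s, 1.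
have s0 : s != 0 by case: hs => ->; rewrite ?oppr_eq0 oner_eq0.
split; first by rewrite mulf_neq0// gt_eqF.
do 2 (split; first by [|left]).
split; first by move=> i j; rewrite orth// val_eqE.
have sum5 (F : nat -> 'rV[R]_5) : \sum_(k < 5) F k = F 0%N + F 1%N + F 2 + F 3 + F 4.
  by rewrite !big_ord_recl big_ord0 /= addr0 !addrA.
have cg x u : center c u -> lbr c x u = 0 by move=> cu; rewrite (lbr_skew lc) cu oppr0.
have br02' : lbr c x0 x2 = 0 by rewrite br02 g20 scaler0.
split.
  move=> i j; rewrite (sum5 (fun k => T1 _ _ i j k *: nth 0 l k)).
  case: i => [[|[|[|[|[|//]]]]] ?]; case: j => [[|[|[|[|[|//]]]]] ?] /=;
    rewrite ?scale0r ?addr0 ?add0r ?(g0c, g1c) ?(cg _ _ g0c) ?(cg _ _ g1c)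
      ?lbr_alt ?br01 ?br02' ?br12 ?mul1r ?a01 //;
    by rewrite (lbr_skew lc) ?br01 ?br02' ?br12 ?scaleNr ?a01 ?oppr0.
move=> i j.
case: i => [[|[|[|[|[|//]]]]] ?]; case: j => [[|[|[|[|[|//]]]]] ?] /=;
  rewrite ?omuu //; first [assumption|rewrite omN ?o00 ?o01 ?o02 ?o10 ?o11 ?o12
     ?og01 ?ox01 ?ox02 ?ox12 ?oppr0 //|idtac];
  rewrite -?omN ?o00 ?o12 ?a01; first [by ring|by case: hs => ->; ring].
Qed.

End NormalForms.

(** * From the Einstein equations to the normal forms *)

Section AdaptedBasis.
Variables (R : realType) (n : nat) (c : 'I_n -> 'I_n -> 'rV[R]_n) (G Om : 'M[R]_n).
Hypothesis lc : is_lie c.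
Hypothesis nil2 : forall u v w, lbr c (lbr c u v) w = 0.
Hypothesis nonab : exists u v, lbr c u v != 0.
Hypothesis LG : lorentzian_metric G.
Hypothesis cd : forall u, center c u <-> derived c u.
Hypothesis coc : is_cocycle c Om.
Variable lam : R.
Hypothesis qe : quasi_einstein1 c G Om lam.
Hypothesis lam_ge0 : 0 <= lam.

Variables (p q : nat) (z : 'I_p.+1 -> 'rV[R]_n) (y : 'I_q -> 'rV[R]_n) (h : 'I_q -> R).
Hypothesis zc : forall i, center c (z i).
Hypothesis zz : forall i j, ip G (z i) (z j) = (i == j)%:R * eps i.
Hypothesis zspan : forall u, center c u -> u = \sum_i (eps i * ip G u (z i)) *: z i.
Hypothesis yy : forall u v, ip G (y u) (y v) = (u == v)%:R.
Hypothesis zy : forall i u, ip G (z i) (y u) = 0.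
Hypothesis zyspan :
  forall v, v = \sum_i (eps i * ip G v (z i)) *: z i + \sum_u ip G v (y u) *: y u.
Hypothesis hdiag : forall u v,
  \sum_i eps i * om Om (z i) (y u) * om Om (z i) (y v) = (u == v)%:R * h u.

Let w (u : 'I_q) : 'rV[R]_n := \sum_i (eps i * om Om (z i) (y u)) *: z i.

(** * The centre and the vectors [w u] *)

Lemma centralP u v : center c u -> lbr c v u = 0.
Proof. by move=> cu; rewrite (lbr_skew lc) cu oppr0. Qed.

Lemma lbr_central u v : center c (lbr c u v).
Proof. by move=> x; rewrite nil2. Qed.

Lemma om_skew u v : om Om u v = - om Om v u.
Proof. by rewrite omE ip_skew//; case: coc. Qed.

Lemma om_lbr_central u v x : center c x -> om Om (lbr c u v) x = 0.
Proof.
move=> cx; have [_ /(_ u v x)] := coc.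
by rewrite cx (centralP v cx) !omE !ip0l !addr0.
Qed.

(** The centre equals the derived algebra, so [u] is a combination of brackets, and the cocycle
    identity with a central third argument has a single term. *)
Lemma om_central u v : center c u -> center c v -> om Om u v = 0.
Proof.
move=> /cd[a ->] cv; rewrite omE ip_suml big1// => i _; rewrite ip_suml big1// => j _.
by rewrite ipZl -(omE Om) om_lbr_central// mulr0.
Qed.

Lemma center_sum (I : finType) (a : I -> R) (x : I -> 'rV[R]_n) :
  (forall i, center c (x i)) -> center c (\sum_i a i *: x i).
Proof.
move=> cx v; rewrite lbr_suml big1// => i _; by rewrite lbrZl cx scaler0.
Qed.

Lemma w_central u : center c (w u).
Proof. exact: center_sum. Qed.

Lemma ip_central_y x u : center c x -> ip G x (y u) = 0.
Proof.
by move=> /zspan->; rewrite ip_suml big1// => i _; rewrite ipZl zy mulr0.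
Qed.

Lemma central_inj x : center c x -> (forall u, om Om x (y u) = 0) -> x = 0.
Proof.
move=> cx xy; have [inj _] := qe; apply: inj => // v.
rewrite (zyspan v) omE ipDr !ip_sumr !big1 ?addr0// => [u|i] _.
  by rewrite ipZr -(omE Om) xy mulr0.
by rewrite ipZr -(omE Om) (om_central cx (zc i)) mulr0.
Qed.

(** On the centre, [w u] represents the functional [om Om _ (y u)]; this turns inner products of
    brackets with [w k] into the constants [b]. *)
Lemma ip_w x u : center c x -> ip G x (w u) = om Om x (y u).
Proof.
move=> cx; rewrite [in RHS](zspan cx) omE ip_sumr ip_suml; apply: eq_bigr => i _.
by rewrite ipZr ipZl -(omE Om); ring.
Qed.

Lemma om_wy u v : om Om (w u) (y v) = (u == v)%:R * h u.
Proof.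
by rewrite -hdiag omE ip_suml; apply: eq_bigr => i _; rewrite ipZl -(omE Om).
Qed.

Lemma ip_ww u v : ip G (w u) (w v) = (u == v)%:R * h u.
Proof. by rewrite ip_w ?om_wy//; exact: w_central. Qed.

Lemma ip_wy u v : ip G (w u) (y v) = 0.
Proof. by rewrite ip_central_y//; exact: w_central. Qed.

(** A null eigenvalue gives the zero vector and not merely a lightlike one: [w u] is then
    [om]-orthogonal to every [y v], so the injectivity condition applies. *)
Lemma w_null u : h u = 0 -> w u = 0.
Proof.
by move=> hu; apply: central_inj => [|v]; [exact: w_central|rewrite om_wy hu mulr0].
Qed.

Lemma om_y_null x u : center c x -> h u = 0 -> om Om x (y u) = 0.
Proof. by move=> cx /w_null wu; rewrite -ip_w// wu ip0r. Qed.

Lemma delta_sum (F : 'I_q -> R) u : \sum_v (v == u)%:R * F v = F u.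
Proof.
rewrite (bigD1 u)//= eqxx mul1r big1 ?addr0// => v /negPf->; by rewrite mul0r.
Qed.

(** Both sides have the same [om] against every [y v], and central vectors are determined by these
    values. *)
Lemma central_span x : center c x -> x = \sum_u (om Om x (y u) / h u) *: w u.
Proof.
move=> cx; apply/eqP; rewrite -subr_eq0; apply/eqP; apply: central_inj => [v|v].
  rewrite -scaleN1r lbrDl lbrZl cx add0r (_ : lbr _ _ _ = 0) ?scaler0//.
  by apply: center_sum => u; exact: w_central.
rewrite omE ipBl ip_suml.
have -> : \sum_u ip Om ((om Om x (y u) / h u) *: w u) (y v) =
          \sum_u (u == v)%:R * (om Om x (y u) / h u * h u).
  by apply: eq_bigr => u _; rewrite ipZl -(omE Om) om_wy; ring.
rewrite delta_sum; have [hv|hv] := eqVneq (h v) 0; last by rewrite divfK// subrr.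
by rewrite hv mulr0 -(omE Om) om_y_null// subr0.
Qed.

Lemma ip_central_sq x : center c x -> ip G x x = \sum_u om Om x (y u) ^+ 2 / h u.
Proof.
move=> cx; rewrite {2}(central_span cx) ip_sumr; apply: eq_bigr => u _.
by rewrite ipZr ip_w//; ring.
Qed.

(** The left summand indexes the [w u], the right one the [y u]. For a null [u], the vector [w u]
    and the inverse of [h u] are both zero. *)
Let e (i : 'I_q + 'I_q) : R := match i with inl u => (h u)^-1 | inr u => 1 end.
Let f (i : 'I_q + 'I_q) : 'rV[R]_n := match i with inl u => w u | inr u => y u end.

Lemma adapted_frame : frame G e f.
Proof.
move=> v; rewrite big_sumType /= {1}(zyspan v); congr (_ + _); last first.
  by apply: eq_bigr => u _; rewrite mul1r.
set x := \sum_i _ *: z i; have cx : center c x by apply: center_sum.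
rewrite (central_span cx); apply: eq_bigr => u _; congr (_ *: _).
rewrite mulrC; congr (_ * _); rewrite -ip_w// (zyspan v) -/x ipDl.
rewrite [X in _ + X]ip_suml [X in _ + X]big1 ?addr0// => u' _.
have [sG _] := LG; by rewrite ipZl (ip_sym (y u') _ sG) ip_wy mulr0.
Qed.

Lemma adapted_trace x i : ip G (lbr c x (f i)) (f i) = 0.
Proof.
case: i => u /=; first by rewrite centralP ?ip0l//; exact: w_central.
by rewrite ip_central_y//; exact: lbr_central.
Qed.

Let b u v k : R := om Om (lbr c (y u) (y v)) (y k).

(** All frame terms with a bracket by a central [w k] drop out, so the bracket sums run over the
    [y k] alone. *)
Lemma qe_frame :
  (forall u v,
    - 2^-1 * (\sum_k ip G (lbr c u (y k)) (lbr c v (y k))) +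
    4^-1 * (\sum_k \sum_l (ip G (lbr c (y k) (y l)) u * ip G (lbr c (y k) (y l)) v)) =
    lam * ip G u v + 2^-1 * (\sum_k (h k)^-1 * om Om u (w k) * om Om v (w k) +
                             \sum_k om Om u (y k) * om Om v (y k))) /\
  2 * (\sum_k h k) + \sum_k \sum_l om Om (y k) (y l) ^+ 2 = 4 * lam.
Proof.
have [sG _] := LG; have [sO _] := coc.
have [_ ric tr] := (quasi_einstein1_frame sG adapted_frame lc nil2 adapted_trace sO lam).1 qe.
split=> [u v|].
  have := ric u v; rewrite !big_sumType /=.
  rewrite [X in _ * (X + _) + _]big1 => [|k _]; last first.
    by rewrite centralP ?ip0l ?mulr0//; exact: w_central.
  rewrite [X in _ + _ * (X + _)]big1 => [|k _]; last first.
    by apply: big1 => i _; rewrite w_central !ip0l !mulr0.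
  rewrite !add0r => E.
  congr (_ * _ + _ * _ = _ * _ + _ * (_ + _)): E.
  - by apply: eq_bigr => k _; rewrite mul1r.
  - apply: eq_bigr => k _; rewrite big_sumType /= big1 => [|l _]; last first.
      by rewrite centralP ?ip0l ?mulr0//; exact: w_central.
    by rewrite add0r; apply: eq_bigr => l _; rewrite !mul1r.
  by apply: eq_bigr => k _; rewrite mul1r.
rewrite -tr !big_sumType /=.
(* The pairs [(w, y)] and [(y, w)] each contribute [h k ^+ 2 / h k = h k], whence the factor 2; the
   pairs [(w, w)] contribute zero. *)
have t1 : \sum_k \sum_i e (inl k) * e i * om Om (w k) (f i) ^+ 2 = \sum_k h k.
  apply: eq_bigr => k _; rewrite big_sumType /= big1 ?add0r => [|l _]; last first.
    by rewrite om_central ?expr0n ?mulr0//; exact: w_central.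
  transitivity (\sum_l (l == k)%:R * h k); last by rewrite delta_sum.
  apply: eq_bigr => l _; rewrite om_wy mulr1 eq_sym; case: eqP => _; last by rewrite !mul0r expr0n mulr0.
  rewrite !mul1r; have [->|hk] := eqVneq (h k) 0; first by rewrite invr0 mul0r.
  by field.
have t2 : \sum_k \sum_i e (inr k) * e i * om Om (y k) (f i) ^+ 2 =
    \sum_k h k + \sum_k \sum_l om Om (y k) (y l) ^+ 2.
  rewrite -big_split; apply: eq_bigr => k _; rewrite big_sumType /=; congr (_ + _).
    transitivity (\sum_l (l == k)%:R * h k); last by rewrite delta_sum.
    apply: eq_bigr => l _; rewrite om_skew sqrrN om_wy mul1r; case: eqP => [->|_]; last by rewrite !mul0r expr0n mulr0.
    rewrite !mul1r; have [->|hk] := eqVneq (h k) 0; first by rewrite invr0 mul0r.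
    by field.
  by apply: eq_bigr => l _; rewrite !mul1r.
rewrite t1 t2; ring.
Qed.

Lemma b_skew u v k : b u v k = - b v u k.
Proof. by rewrite /b (lbr_skew lc) omE ipNl. Qed.

Lemma b_cyc u v k : b u v k + b v k u + b k u v = 0.
Proof. by have [_] := coc; exact. Qed.

Lemma b_null u v k : h k = 0 -> b u v k = 0.
Proof. by move=> hk; rewrite /b om_y_null//; exact: lbr_central. Qed.

Lemma lbr_y u v : lbr c (y u) (y v) = \sum_k (b u v k / h k) *: w k.
Proof. by rewrite -central_span//; exact: lbr_central. Qed.

Lemma ricci_w k : \sum_u \sum_v b u v k ^+ 2 = 4 * lam * h k + 2 * h k ^+ 2.
Proof.
have [/(_ (w k) (w k)) + _] := qe_frame.
rewrite [X in _ * X + _]big1 => [|i _]; last by rewrite w_central ip0l.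
rewrite ip_ww eqxx mul1r [X in _ * (X + _)]big1 => [|i _]; last first.
  by rewrite om_central ?mulr0//; exact: w_central.
have -> : \sum_i om Om (w k) (y i) * om Om (w k) (y i) = h k ^+ 2.
  transitivity (\sum_i (i == k)%:R * h k ^+ 2); last by rewrite delta_sum.
  by apply: eq_bigr => i _; rewrite om_wy eq_sym; case: (i == k); rewrite ?mul0r// !mul1r.
have -> : \sum_i \sum_l ip G (lbr c (y i) (y l)) (w k) * ip G (lbr c (y i) (y l)) (w k) =
    \sum_u \sum_v b u v k ^+ 2.
  apply: eq_bigr => u _; apply: eq_bigr => v _.
  by rewrite ip_w ?expr2//; exact: lbr_central.
by lra.
Qed.

Lemma ricci_y u : \sum_v \sum_k b u v k ^+ 2 / h k + 2 * lam + h u +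
  \sum_k om Om (y u) (y k) ^+ 2 = 0.
Proof.
have [/(_ (y u) (y u)) + _] := qe_frame.
rewrite [X in _ + _ * X = _]big1 => [|k _]; last first.
  by apply: big1 => l _; rewrite ip_central_y ?mul0r//; exact: lbr_central.
rewrite yy eqxx mulr1.
have -> : \sum_k (h k)^-1 * om Om (y u) (w k) * om Om (y u) (w k) = h u.
  transitivity (\sum_k (k == u)%:R * h u); last by rewrite delta_sum.
  apply: eq_bigr => k _; rewrite om_skew om_wy; case: eqP => [->|_]; last by rewrite !mul0r oppr0 mulr0.
  rewrite !mul1r; have [->|hu] := eqVneq (h u) 0; first by rewrite oppr0 !mulr0.
  by field.
have -> : \sum_k ip G (lbr c (y u) (y k)) (lbr c (y u) (y k)) =
   \sum_v \sum_k b u v k ^+ 2 / h k.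
  by apply: eq_bigr => v _; rewrite ip_central_sq//; exact: lbr_central.
under [X in _ = _ + _ * (_ + X)]eq_bigr do rewrite -expr2.
by lra.
Qed.

(** The mixed Ricci component at [w u, y k]: its curvature side vanishes, as [w u] is central and
    brackets are orthogonal to [y k], and the other side is a multiple of
    [h u * om Om (y k) (y u)]. *)
Lemma om_yy_null u k : h u != 0 -> om Om (y u) (y k) = 0.
Proof.
move=> hu; have [/(_ (w u) (y k)) + _] := qe_frame.
rewrite [X in _ * X + _]big1 => [|i _]; last by rewrite w_central ip0l.
rewrite [X in _ + _ * X = _]big1 => [|i _]; last first.
  by apply: big1 => l _; rewrite (ip_central_y k) ?mulr0//; exact: lbr_central.
rewrite ip_wy [X in _ * (X + _)]big1 => [|i _]; last first.
  by rewrite om_central ?mulr0 ?mul0r//; exact: w_central.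
have -> : \sum_i om Om (w u) (y i) * om Om (y k) (y i) = h u * om Om (y k) (y u).
  transitivity (\sum_i (i == u)%:R * (h u * om Om (y k) (y i))); last by rewrite delta_sum.
  by apply: eq_bigr => i _; rewrite om_wy eq_sym; ring.
rewrite !mulr0 !add0r => /esym/eqP; rewrite !mulf_eq0 invr_eq0 pnatr_eq0 (negPf hu) /=.
by move/eqP => E; rewrite om_skew E oppr0.
Qed.

(** Distinct [w u] and [w v] are orthogonal, and a Lorentzian form has no two orthogonal timelike
    vectors. *)
Lemma timelike_w_unique u v : h u < 0 -> h v < 0 -> u = v.
Proof.
move=> hu hv; have [//|/negPf uv] := eqVneq u v.
have := timelike_orthogonal (u := w u) (v := w v) LG.
rewrite !ip_ww !eqxx uv !mul1r mul0r => /(_ hu erefl).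
have [w0|_ /(_ isT)] := eqVneq (w v) 0; last by rewrite ltNge (ltW hv).
by have := ip_ww v v; rewrite w0 ip0l eqxx mul1r => hv0; rewrite -hv0 ltxx in hv.
Qed.

(** Were all [h u] nonnegative, [ip_central_sq] would give the timelike central vector [z ord0] a
    nonnegative square. *)
Lemma timelike_w_exists : exists o, h o < 0.
Proof.
have [/existsP//|/existsPn nh] := boolP [exists o, h o < 0].
have := ip_central_sq (zc ord0); rewrite zz eqxx mul1r /eps eqxx => E.
have : 0 <= \sum_u om Om (z ord0) (y u) ^+ 2 / h u.
  apply: sumr_ge0 => u _; rewrite mulr_ge0 ?sqr_ge0// invr_ge0 leNgt; exact: nh.
by rewrite -E leNgt ltrN10.
Qed.

Lemma b_nonzero : exists u v k, b u v k != 0.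
Proof.
have [/existsP[u /existsP[v /existsP[k nz]]]|/existsPn nb] :=
  boolP [exists u, exists v, exists k, b u v k != 0]; first by exists u, v, k.
have b00 u v k : b u v k = 0.
  by have := nb u => /existsPn/(_ v)/existsPn/(_ k); rewrite negbK => /eqP.
have y0 u v : lbr c (y u) (y v) = 0.
  by rewrite lbr_y big1// => k _; rewrite b00 mul0r scale0r.
have vy v u : lbr c v (y u) = 0.
  rewrite (zyspan v) lbrDl !lbr_suml !big1 ?addr0// => [k|i] _.
    by rewrite lbrZl y0 scaler0.
  by rewrite lbrZl zc scaler0.
have [u [v /eqP[]]] := nonab.
rewrite (zyspan v) lbrDr !lbr_sumr !big1 ?addr0// => [k|i] _.
  by rewrite lbrZr vy scaler0.
by rewrite lbrZr (centralP _ (zc i)) scaler0.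
Qed.

(** The combination of the [y u] with coefficients [x u] would be central, while central vectors are
    orthogonal to every [y u]. *)
Lemma b_nondegenerate (x : 'I_q -> R) :
  (forall v k, \sum_u x u * b u v k = 0) -> forall u, x u = 0.
Proof.
move=> x0 u; pose X := \sum_u x u *: y u.
have Xy v : lbr c X (y v) = 0.
  apply: central_inj => [|k]; first exact: lbr_central.
  rewrite -[RHS](x0 v k) lbr_suml omE ip_suml; apply: eq_bigr => i _.
  by rewrite lbrZl ipZl.
have cX : center c X.
  move=> v; rewrite (zyspan v) lbrDr !lbr_sumr !big1 ?addr0// => [k|i] _.
    by rewrite lbrZr Xy scaler0.
  by rewrite lbrZr (centralP _ (zc i)) scaler0.
have := ip_central_y u cX; rewrite ip_suml => <-.
rewrite -[LHS](delta_sum x); apply: eq_bigr => v _.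
by rewrite ipZl yy mulrC.
Qed.

Theorem normal_form : lam = 0 /\ (forall u v, om Om (y u) (y v) = 0) /\
  exists o j k s,
    [/\ h o < 0, [/\ o != j, o != k, j != k & forall u, [\/ u = o, u = j | u = k]],
        [/\ 0 <= h j, 0 < h k & h j + h k = - h o],
        s = 1 \/ s = -1 &
        [/\ lbr c (y o) (y j) = s *: w k, lbr c (y o) (y k) = - s *: w j
           & lbr c (y j) (y k) = s *: w o]].
Proof.
have [o ho] := timelike_w_exists.
have [_ E3] := qe_frame.
have [l0 [B0 [j [k [s [ijk hjk hs [ojk okj jko] [oo oii jkj jkk]]]]]]] :=
  structure_constants b_skew b_cyc b_null ricci_w ricci_y om_yy_null E3 lam_ge0 ho
  (fun u hu => timelike_w_unique hu ho) b_nonzero b_nondegenerate.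
split=> //; split=> //; exists o, j, k, s; split=> //.
have [oj ok jk ex] := ijk; have [hj hk hjk'] := hjk.
have ho0 : h o != 0 by rewrite lt_eqF.
have hk0 : h k != 0 by rewrite gt_eqF.
have expand u v (a : 'I_q) : (forall i, i != a -> b u v i = 0) ->
    lbr c (y u) (y v) = (b u v a / h a) *: w a.
  move=> ba; rewrite lbr_y (bigD1 a)//= big1 ?addr0// => i /ba->.
  by rewrite mul0r scale0r.
split.
- rewrite (expand _ _ k) ?ojk ?mulfK// => i ik; have [->|->|E] := ex i; rewrite ?oo ?oii//.
  by rewrite E eqxx in ik.
- rewrite (expand _ _ j) ?okj => [|i ij].
    have [hj0|hj0] := eqVneq (h j) 0; first by rewrite w_null// !scaler0.
    by rewrite mulNr mulfK.
  by have [->|E|->] := ex i; rewrite ?oo ?oii//; rewrite E eqxx in ij.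
rewrite (expand _ _ o) ?jko ?mulfK// => i io; have [E|->|->] := ex i; rewrite ?jkj ?jkk//.
by rewrite E eqxx in io.
Qed.

Theorem normal_form_cases : lam = 0 /\ (case1 c G Om \/ case2 c G Om).
Proof.
have [sG _] := LG; have [sO _] := coc.
have [l0 [yy0 [o [j [k [s [ho [oj ok jk ex] [hj hk hjk] hs [b01 b02 b12]]]]]]]] := normal_form.
split=> //.
(* [g u] is [w u] normalised; for a null [u] it is the zero vector. *)
pose a u := Num.sqrt `|h u|; pose g u := (a u)^-1 *: w u.
have aa u : a u ^+ 2 = `|h u| by rewrite sqr_sqrtr.
have ah u : h u != 0 -> 0 < a u by move=> hu; rewrite sqrtr_gt0 normr_gt0.
have hE u : h u != 0 -> h u = Num.sg (h u) * a u ^+ 2 by rewrite aa -numEsg.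
have gc u : center c (g u) by move=> v; rewrite lbrZl w_central scaler0.
have wg u : w u = a u *: g u.
  have [hu|hu] := eqVneq (h u) 0; first by rewrite /g w_null// !scaler0.
  by rewrite scalerA mulfV ?scale1r// gt_eqF// ah.
have gy u v : ip G (g u) (y v) = 0 by rewrite ipZl ip_wy mulr0.
have gg u v : ip G (g u) (g v) = (u == v)%:R * Num.sg (h u).
  rewrite ipZl ipZr ip_ww; case: eqP => [<-|_]; last by rewrite !mul0r !mulr0.
  have [hu|hu] := eqVneq (h u) 0; first by rewrite hu sgr0 !mulr0.
  by have := ah _ hu => au; rewrite {1}(hE _ hu); field; rewrite gt_eqF.
have ogy u v : om Om (g u) (y v) = (u == v)%:R * (Num.sg (h u) * a u).
  rewrite omE ipZl -(omE Om) om_wy; case: eqP => [_|_]; last by rewrite !mul0r mulr0.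
  have [hu|hu] := eqVneq (h u) 0; first by rewrite hu sgr0 !(mulr0, mul0r).
  by have := ah _ hu => au; rewrite {1}(hE _ hu); field; rewrite gt_eqF.
have ogg u v : om Om (g u) (g v) = 0 by exact: om_central.
have gexp u v : (ip G v (w u) / h u) *: w u = (Num.sg (h u) * ip G v (g u)) *: g u.
  have [hu|hu] := eqVneq (h u) 0; first by rewrite w_null// hu sgr0 mul0r scaler0 scale0r.
  have := ah _ hu => au; rewrite ipZr scalerA; congr (_ *: _).
  have sg2 : Num.sg (h u) ^+ 2 = 1 by rewrite sqr_sg hu.
  rewrite {1}(hE _ hu) invfM; have -> : (Num.sg (h u))^-1 = Num.sg (h u).
    by rewrite -[LHS]mulr1 -sg2 expr2 mulKf// sgr_eq0.
  by field; rewrite gt_eqF.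
have span v : v = - ip G v (g o) *: g o + ip G v (g k) *: g k + (Num.sg (h j) * ip G v (g j)) *: g j
    + (ip G v (y o) *: y o + ip G v (y j) *: y j + ip G v (y k) *: y k).
  rewrite {1}(adapted_frame v) big_sumType /= !(sum_three _ oj ok jk ex) !mul1r.
  congr (_ + _); rewrite ![(h _)^-1 * _]mulrC !gexp (ltr0_sg ho) (gtr0_sg hk) mulN1r mul1r.
  by rewrite addrAC.
have jo : j != o by rewrite eq_sym.
have ko : k != o by rewrite eq_sym.
have kj : k != j by rewrite eq_sym.
have sgo := ltr0_sg ho; have sgk := gtr0_sg hk.
have a012 : a o ^+ 2 = a k ^+ 2 + a j ^+ 2.
  by rewrite !aa (ltr0_norm ho) (gtr0_norm hk) (ger0_norm hj) -hjk addrC.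
have a0_gt0 : 0 < a o by rewrite ah// lt_eqF.
have a1_gt0 : 0 < a k by rewrite ah// gt_eqF.
have b01' : lbr c (y o) (y j) = (s * a k) *: g k by rewrite b01 wg scalerA.
have b02' : lbr c (y o) (y k) = (- s * a j) *: g j by rewrite b02 wg scalerA.
have b12' : lbr c (y j) (y k) = (s * a o) *: g o by rewrite b12 wg scalerA.
(* A null [h j] makes [g j] vanish and leaves five basis vectors; a positive one gives six. *)
have [hj0|hj0] := eqVneq (h j) 0.
  have aj0 : a j = 0 by rewrite /a hj0 normr0 sqrtr0.
  have gj0 : g j = 0 by rewrite /g w_null// scaler0.
  left; apply: (case1_intro sG lc sO hs (gc o) (gc k) (gc j) b01' b02' b12').
  all: rewrite ?ogy ?gg ?yy ?gy ?ogg ?yy0 ?eqxx ?(negPf oj) ?(negPf ok) ?(negPf jk)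
    ?(negPf jo) ?(negPf ko) ?(negPf kj) ?sgo ?sgk ?aj0 ?mulr0 ?mul0r ?mul1r ?mulN1r //.
  - by move=> v; rewrite {1}(span v) gj0 !scaler0.
  - by rewrite a012 aj0.
right; have hj1 : 0 < h j by rewrite lt_def hj0.
have sgj := gtr0_sg hj1.
apply: (case2_intro sG lc sO hs (gc o) (gc k) (gc j) b01' b02' b12').
all: rewrite ?ogy ?gg ?yy ?gy ?ogg ?yy0 ?eqxx ?(negPf oj) ?(negPf ok) ?(negPf jk)
    ?(negPf jo) ?(negPf ko) ?(negPf kj) ?sgo ?sgk ?sgj ?mul0r ?mul1r ?mulN1r //.
- by move=> v; rewrite {1}(span v) sgj mul1r.
- exact: ah.
Qed.

End AdaptedBasis.

Theorem quasi_einstein1_classification (R : realType) (n : nat)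
    (c : 'I_n -> 'I_n -> 'rV[R]_n) (G Om : 'M[R]_n) (lam : R) :
  is_lie c -> two_step_nilpotent c -> lorentzian_metric G ->
  (forall u, center c u <-> derived c u) -> lorentzian_on G (center c) ->
  is_cocycle c Om -> quasi_einstein1 c G Om lam -> 0 <= lam ->
  lam = 0 /\ (case1 c G Om \/ case2 c G Om).
Proof.
move=> lc [nil2 nonab] LG cd /lorentzian_basis[p [z [zc zz zspan]]] coc qe lam0.
have [q [y [h [yy zy zyspan hdiag]]]] := adapted_basis Om LG zz.
exact: (normal_form_cases lc nil2 nonab LG cd coc qe lam0 zc zz zspan yy zy zyspan hdiag).
Qed.

(** * The normal forms are quasi-Einstein *)

Section StructureConstantsConverse.
Variables (R : realType) (n : nat) (c : 'I_n -> 'I_n -> 'rV[R]_n) (G Om : 'M[R]_n).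
Hypothesis sG : G^T = G.
Hypothesis lc : is_lie c.
Hypothesis nil2 : forall u v w, lbr c (lbr c u v) w = 0.
Hypothesis sO : Om^T = - Om.
Variables (f : 'I_n -> 'rV[R]_n) (T : nat -> nat -> nat -> R) (W : nat -> nat -> R).
Hypothesis orth : Defs.orthonormal G f.
Hypothesis fT : forall i j, lbr c (f i) (f j) = \sum_(k < n) T i j k *: f k.
Hypothesis fW : forall i j, om Om (f i) (f j) = W i j.
Local Notation e i := (if nat_of_ord i == 0%N then -1 else 1 : R).
Hypothesis T_adapted : forall i j : 'I_n, T j i i = 0.
Hypothesis TW_inj : forall x : 'I_n -> R,
  (forall j l : 'I_n, \sum_(i < n) x i * T i j l = 0) ->
  (forall j : 'I_n, \sum_(i < n) x i * W i j = 0) -> forall i, x i = 0.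
(** Four times the Ricci equation with zero Einstein constant, in coordinates: [e k * T i j k] is
    the inner product of [[f i, f j]] with [f k]. *)
Hypothesis TW_ricci : forall i j : 'I_n,
  - 2 * (\sum_(k < n) \sum_(l < n) e k * e l * T i k l * T j k l) +
  \sum_(k < n) \sum_(l < n) e k * e l * (e i * T k l i) * (e j * T k l j) =
  2 * \sum_(k < n) e k * W i k * W j k.
Hypothesis W_trace : \sum_(k < n) \sum_(l < n) e k * e l * W k l ^+ 2 = 0.

Let fr : frame G (fun i => e i) f. Proof. exact: orthonormal_frame. Qed.

Let e_sq (i : 'I_n) : e i * e i = 1.
Proof. by case: ifP => _; rewrite ?mulrNN mulr1. Qed.

Let ip_br i j k : ip G (lbr c (f i) (f j)) (f k) = e k * T i j k.
Proof.
rewrite fT ip_suml (bigD1 k)//= big1 ?addr0 => [|l /negPf lk].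
  by rewrite ipZl orth eqxx mulrC.
by rewrite ipZl orth lk mulr0.
Qed.

Let adf w i : ip G (lbr c w (f i)) (f i) = 0.
Proof.
rewrite (fr w) lbr_suml ip_suml big1// => j _.
by rewrite lbrZl ipZl ip_br T_adapted !mulr0.
Qed.

Let ricci_frame i j : ric_form c G (f i) (f j) = 2^-1 * \sum_k e k * om Om (f i) (f k) * om Om (f j) (f k).
Proof.
rewrite (ric_form_frame sG fr lc nil2 adf).
transitivity (2^-1 * \sum_(k < n) e k * W i k * W j k); last first.
  by congr (_ * _); apply: eq_bigr => k _; rewrite !fW.
have -> : 2^-1 * (\sum_(k < n) e k * W i k * W j k) =
    4^-1 * (2 * \sum_(k < n) e k * W i k * W j k) by field.
rewrite -TW_ricci mulrDr mulrA (_ : 4^-1 * - 2 = - 2^-1); last by field.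
congr (_ * _ + _ * _).
  apply: eq_bigr => k _; rewrite (frame_ip sG fr) mulr_sumr; apply: eq_bigr => l _.
  rewrite !ip_br; transitivity ((e l * e l) * (e k * e l * T i k l * T j k l)); first by ring.
  by rewrite e_sq mul1r.
apply: eq_bigr => k _; apply: eq_bigr => l _; rewrite !ip_br; ring.
Qed.

Lemma quasi_einstein1_constants : quasi_einstein1 c G Om 0.
Proof.
(* Symmetry of the Ricci form lets the equation pass from pairs of basis vectors to one arbitrary
   argument, then to the other. *)
have ricS u v : ric_form c G u v = ric_form c G v u.
  rewrite !(ric_form_frame sG fr lc nil2 adf); congr (_ * _ + _ * _).
    by apply: eq_bigr => k _; rewrite (ip_sym _ _ sG).
  by apply: eq_bigr => k _; apply: eq_bigr => l _; rewrite [X in _ * X]mulrC.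
have ricf i v : ric_form c G (f i) v = 2^-1 * \sum_k e k * om Om (f i) (f k) * om Om v (f k).
  have -> : ric_form c G (f i) v = ip G (2^-1 *: (f i *m Dmat G Om)) v.
    rewrite -(Ric_ip c fr); congr (ip G _ v); apply: (frame_ext fr) => j.
    by rewrite (Ric_ip c fr) ricci_frame ipZl (Dmat_ip sG fr sO).
  by rewrite ipZl (Dmat_ip sG fr sO).
split; last split.
- move=> u cu omu; rewrite (fr u) big1// => i _.
  suff -> : e i * ip G u (f i) = 0 by rewrite scale0r.
  apply: (TW_inj (x := fun i => e i * ip G u (f i))) => [j l|j].
    have : ip G (lbr c u (f j)) (f l) * e l = 0 by rewrite cu ip0l mul0r.
    rewrite {1}(fr u) lbr_suml ip_suml mulr_suml => E; rewrite -[RHS]E.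
    apply: eq_bigr => k _.
    rewrite lbrZl ipZl ip_br; transitivity ((e l * e l) * (e k * ip G u (f k) * T k j l)).
      by rewrite e_sq mul1r.
    by ring.
  rewrite -[RHS](omu (f j)) [in RHS](fr u) omE ip_suml; apply: eq_bigr => k _.
  by rewrite ipZl -(omE Om) fW.
- move=> u; apply: (frame_ext fr) => j.
  rewrite (Ric_ip c fr) ricS ricf scale0r add0r ipZl (Dmat_ip sG fr sO); congr (_ * _).
  by apply: eq_bigr => k _; rewrite -!mulrA [X in _ * X]mulrC.
rewrite (Smat_trace sG fr sO) mulr0; under eq_bigr do under eq_bigr do rewrite fW.
by rewrite W_trace oppr0.
Qed.

End StructureConstantsConverse.

Section Converse.
Variables (R : realType) (n : nat) (c : 'I_n -> 'I_n -> 'rV[R]_n) (G Om : 'M[R]_n).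
Hypothesis sG : G^T = G.
Hypothesis lc : is_lie c.
Hypothesis nil2 : forall u v w, lbr c (lbr c u v) w = 0.
Hypothesis sO : Om^T = - Om.

Lemma sum5 (F : 'I_5 -> R) : \sum_k F k = F (@Ordinal 5 0 isT) + F (@Ordinal 5 1 isT) +
  F (@Ordinal 5 2 isT) + F (@Ordinal 5 3 isT) + F (@Ordinal 5 4 isT).
Proof.
rewrite !big_ord_recl big_ord0 addr0 !addrA.
by repeat congr (_ + _); congr F; apply: val_inj.
Qed.

Lemma sum6 (F : 'I_6 -> R) : \sum_k F k = F (@Ordinal 6 0 isT) + F (@Ordinal 6 1 isT) +
  F (@Ordinal 6 2 isT) + F (@Ordinal 6 3 isT) + F (@Ordinal 6 4 isT) + F (@Ordinal 6 5 isT).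
Proof.
rewrite !big_ord_recl big_ord0 addr0 !addrA.
by repeat congr (_ + _); congr F; apply: val_inj.
Qed.

Lemma quasi_einstein1_case1 : case1 c G Om -> quasi_einstein1 c G Om 0.
Proof.
move=> [n5 [b [a [eps [eta [a0 [heps [heta [orth [bT bW]]]]]]]]]]; subst n.
apply: (quasi_einstein1_constants sG lc nil2 sO orth bT bW).
- by case=> [[|[|[|[|[|//]]]]] ?]; case=> [[|[|[|[|[|//]]]]] ?].
- move=> x xT xW.
  have cancel y s : s = 1 \/ s = -1 -> y * (s * a) = 0 -> y = 0.
    by case=> -> /eqP; rewrite !mulf_eq0 ?oppr_eq0 oner_eq0 (negPf a0) !orbF => /eqP.
  have es : eta * eps = 1 \/ eta * eps = -1.
    by case: heps => ->; case: heta => ->; [left|right|right|left]; ring.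
  (* Each chosen component contains exactly one coordinate of [x], multiplied by [a] up to sign. *)
  have e2 := xT (@Ordinal 5 3 isT) (@Ordinal 5 1 isT).
  have e3 := xT (@Ordinal 5 2 isT) (@Ordinal 5 1 isT).
  have e4 := xT (@Ordinal 5 3 isT) (@Ordinal 5 0 isT).
  have e0 := xW (@Ordinal 5 2 isT). have e1 := xW (@Ordinal 5 4 isT).
  rewrite !sum5 /= in e0 e1 e2 e3 e4.
  have x0 : x (@Ordinal 5 0 isT) = 0 by apply: (cancel _ _ es); lra.
  have x1 : x (@Ordinal 5 1 isT) = 0 by apply: (cancel _ _ heps); lra.
  have x2 : x (@Ordinal 5 2 isT) = 0 by apply: (cancel _ 1); [left|lra].
  have x3 : x (@Ordinal 5 3 isT) = 0 by apply: (cancel _ 1); [left|lra].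
  have x4 : x (@Ordinal 5 4 isT) = 0 by apply: (cancel _ _ heta); lra.
  by case=> [[|[|[|[|[|//]]]]] i5]; rewrite (bool_irrelevance i5 isT).
- have eps2 : eps * eps = 1 by case: heps => ->; ring.
  have eta2 : eta * eta = 1 by case: heta => ->; ring.
  case=> [[|[|[|[|[|//]]]]] ?]; case=> [[|[|[|[|[|//]]]]] ?]; rewrite !sum5 /=;
    ring: eps2 eta2.
by case: heps => ->; case: heta => ->; rewrite !sum5 /=; ring.
Qed.

Lemma quasi_einstein1_case2 : case2 c G Om -> quasi_einstein1 c G Om 0.
Proof.
move=> [n6 [b [a2 [a3 [eps [eta]]]]]].
set a := Num.sqrt _ => /= -[a20 [a30 [heps [heta [orth [bT bW]]]]]]; subst n.
have a_sq : a ^+ 2 = a2 ^+ 2 + a3 ^+ 2 by rewrite sqr_sqrtr ?addr_ge0 ?sqr_ge0.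
have a0 : a != 0.
  by rewrite -sqrf_eq0 a_sq paddr_eq0 ?sqr_ge0// !sqrf_eq0 (negPf a20).
(* The square root is generalised: [a_sq] and [a0] suffice for the remaining polynomial
   identities. *)
move: a a_sq a0 bT bW => a a_sq a0 bT bW.
apply: (quasi_einstein1_constants sG lc nil2 sO orth bT bW).
- by case=> [[|[|[|[|[|[|//]]]]]] ?]; case=> [[|[|[|[|[|[|//]]]]]] ?].
- move=> x xT xW.
  have cancel (y s a' : R) : a' != 0 -> s = 1 \/ s = -1 -> y * (s * a') = 0 -> y = 0.
    by move=> /negPf a'0; case=> -> /eqP; rewrite !mulf_eq0 ?oppr_eq0 oner_eq0 a'0 !orbF => /eqP.
  have es : eta * eps = 1 \/ eta * eps = -1.
    by case: heps => ->; case: heta => ->; [left|right|right|left]; ring.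
  (* Again one coordinate of [x] per component, with factor [a], [a2] or [a3] up to sign. *)
  have e3 := xT (@Ordinal 6 4 isT) (@Ordinal 6 1 isT).
  have e4 := xT (@Ordinal 6 3 isT) (@Ordinal 6 1 isT).
  have e5 := xT (@Ordinal 6 3 isT) (@Ordinal 6 2 isT).
  have e0 := xW (@Ordinal 6 3 isT). have e1 := xW (@Ordinal 6 5 isT).
  have e2 := xW (@Ordinal 6 4 isT).
  rewrite !sum6 /= in e0 e1 e2 e3 e4 e5.
  have x0 : x (@Ordinal 6 0 isT) = 0 by apply: (cancel _ _ a a0 heta); lra.
  have x1 : x (@Ordinal 6 1 isT) = 0 by apply: (cancel _ _ a2 a20 es); lra.
  have x2 : x (@Ordinal 6 2 isT) = 0 by apply: (cancel _ _ a3 a30 es); lra.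
  have x3 : x (@Ordinal 6 3 isT) = 0 by apply: (cancel _ 1 a2 a20); [left|lra].
  have x4 : x (@Ordinal 6 4 isT) = 0 by apply: (cancel _ 1 a2 a20); [left|lra].
  have x5 : x (@Ordinal 6 5 isT) = 0 by apply: (cancel _ 1 a3 a30); [left|lra].
  by case=> [[|[|[|[|[|[|//]]]]]] i6]; rewrite (bool_irrelevance i6 isT).
- have eps2 : eps * eps = 1 by case: heps => ->; ring.
  have eta2 : eta * eta = 1 by case: heta => ->; ring.
  case=> [[|[|[|[|[|[|//]]]]]] ?]; case=> [[|[|[|[|[|[|//]]]]]] ?]; rewrite !sum6 /=;
    ring: a_sq eps2 eta2.
by case: heps => ->; case: heta => ->; rewrite !sum6 /=; ring: a_sq.
Qed.

End Converse.

Unset Implicit Arguments.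

Theorem theorem4p2 (R : realType) (n : nat) (c : 'I_n -> 'I_n -> 'rV[R]_n)
    (G Om : 'M[R]_n) :
  is_lie c -> two_step_nilpotent c -> lorentzian_metric G ->
  (forall u, center c u <-> derived c u) ->
  lorentzian_on G (center c) ->
  is_cocycle c Om ->
  forall lam : R,
    (quasi_einstein1 c G Om lam /\ 0 <= lam) <->
    (lam = 0 /\ (case1 c G Om \/ case2 c G Om)).
Proof.
move=> lc nil LG cd LZ coc lam; split=> [[qe lam0]|[-> cases]].
  exact: (quasi_einstein1_classification lc nil LG cd LZ coc qe lam0).
have [nil2 _] := nil; have [sG _] := LG; have [sO _] := coc.
split=> //; have [h|h] := cases.
  exact: (quasi_einstein1_case1 sG lc nil2 sO h).
exact: (quasi_einstein1_case2 sG lc nil2 sO h).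
Qed.
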